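(* For every EFD-sentence $\varphi$ in the language $\{+,\neg,0\}$ with a model in $\mathcal{P}$, either $\varphi\sim\forall x\,2x=x$ in $\mathsf{V}(\mathcal{P})$ or there is a positive integer $k$ such that $\varphi\sim\varepsilon_k$ in $\mathsf{V}(\mathcal{P})$.
   Context: An MV-algebra is an algebra $(A,+,\neg,0)$ with $(A,+,0)$ an Abelian monoid, $\neg\neg x=x$, $x+\neg0=\neg0$, $\neg(\neg x+y)+y=\neg(\neg y+x)+x$. Write $x\vee y:=\neg(\neg x+y)+y$, $x\wedge y:=\neg(\neg x\vee\neg y)$, $x*y:=\neg(\neg x+\neg y)$, $kx=x+\dots+x$ and $x^k=x*\dots*x$ ($k$ times). The radical $\mathrm{rad}\,\mathbf A$ is the intersection of all maximal ideals (ideals: nonempty down-sets closed under $+$). $\mathbf A$ is perfect if it is nontrivial and $A=\mathrm{rad}\,\mathbf A\cup\{\neg a:a\in\mathrm{rad}\,\mathbf A\}$. $\mathcal P$ is the class of perfect MV-algebras, $\mathsf V(\mathcal P)$ the variety generated by it. $\mathsf t_k(z):=(kz\wedge\neg2z^2)\vee z^k$ and $\varepsilon_k:=\forall x\exists! z\,\mathsf t_k(z)=x$. An EFD-sentence is a sentence $\forall x_1\dots x_n\exists! z_1\dots z_m\bigwedge_{i=1}^k s_i(\bar x,\bar z)=t_i(\bar x,\bar z)$ with terms $s_i,t_i$, $n\ge0$, $m\ge1$. $\varphi\sim\psi$ in $\mathcal K$ means every member of $\mathcal K$ satisfies $\varphi$ iff it satisfies $\psi$. *)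

(* Defs.v *)
From mathcomp Require Import all_boot all_order.

Set Implicit Arguments.
Unset Strict Implicit.
Unset Printing Implicit Defensive.

(* Structures for the language {+, ~, 0}; no axioms are imposed here, so that
   terms also form such a structure and derived operations are defined once. *)
Record mvstruct := MvStruct {
  mv_carrier :> Type;
  mv_add : mv_carrier -> mv_carrier -> mv_carrier;
  mv_neg : mv_carrier -> mv_carrier;
  mv_zero : mv_carrier
}.

Declare Scope mv_scope.
Delimit Scope mv_scope with mv.
Bind Scope mv_scope with mv_carrier.

Notation "x + y" := (mv_add x y) : mv_scope.
Notation "~` x" := (mv_neg x) : mv_scope.
Notation "0" := (mv_zero _) : mv_scope.

Section DerivedOperations.
Local Open Scope mv_scope.
Variable A : mvstruct.
Implicit Types x y z : A.

Definition mv_join x y : A := ~` (~` x + y) + y.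
Definition mv_meet x y : A := ~` (mv_join (~` x) (~` y)).
Definition mv_mul x y : A := ~` (~` x + ~` y).
Definition mv_nat k x : A := iterop k (@mv_add A) x 0.
Definition mv_exp k x : A := iterop k mv_mul x (~` 0).
Definition mv_le x y : Prop := mv_join x y = y.

End DerivedOperations.

Notation "x `|` y" := (mv_join x y) : mv_scope.
Notation "x `&` y" := (mv_meet x y) : mv_scope.
Notation "x * y" := (mv_mul x y) : mv_scope.
Notation "x *+ k" := (mv_nat k x) : mv_scope.
Notation "x ^+ k" := (mv_exp k x) : mv_scope.

Definition mv_t (A : mvstruct) (k : nat) (z : A) : A :=
  ((z *+ k `&` ~` ((z ^+ 2) *+ 2)) `|` z ^+ k)%mv.

Record mv_algebra (A : mvstruct) : Prop := MvAlgebra {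
  mv_addA : forall x y z : A, (x + (y + z) = (x + y) + z)%mv;
  mv_addC : forall x y : A, (x + y = y + x)%mv;
  mv_addx0 : forall x : A, (x + 0 = x)%mv;
  mv_negK : forall x : A, (~` (~` x) = x)%mv;
  mv_addx1 : forall x : A, (x + ~` 0 = ~` 0)%mv;
  mv_joinC : forall x y : A,
    (~` (~` x + y) + y = ~` (~` y + x) + x)%mv
}.

Section Radical.
Variable A : mvstruct.
Implicit Types (I J : A -> Prop) (a x y : A).

Record ideal I : Prop := Ideal {
  ideal_nonempty : exists x, I x;
  ideal_down : forall x y, mv_le x y -> I y -> I x;
  ideal_add : forall x y, I x -> I y -> I (x + y)%mv
}.

Definition proper I : Prop := exists x, ~ I x.

Definition maximal_ideal I : Prop :=
  [/\ ideal I, proper I &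
      forall J, ideal J -> proper J ->
        (forall x, I x -> J x) -> forall x, J x -> I x].

Definition mv_rad a : Prop := forall I, maximal_ideal I -> I a.

End Radical.

Definition perfect (A : mvstruct) : Prop :=
  [/\ mv_algebra A,
      exists x y : A, x <> y &
      forall x : A, mv_rad x \/ exists2 a : A, mv_rad a & x = (~` a)%mv].

Inductive term (V : Type) : Type :=
  | Var of V
  | TZero
  | TNeg of term V
  | TAdd of term V & term V.
Arguments TZero {V}.

Canonical term_mvstruct (V : Type) : mvstruct :=
  MvStruct (@TAdd V) (@TNeg V) TZero.

Fixpoint eval (V : Type) (A : mvstruct) (v : V -> A) (t : term V) : A :=
  match t with
  | Var i => v i
  | TZero => 0%mv
  | TNeg s => (~` eval v s)%mv
  | TAdd s1 s2 => (eval v s1 + eval v s2)%mv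
  end.

(* Equations over a countable supply of variables, universally quantified. *)
Definition equation : Type := term nat * term nat.

Definition satisfies_eq (A : mvstruct) (e : equation) : Prop :=
  forall v : nat -> A, eval v e.1 = eval v e.2.

Definition variety (K : mvstruct -> Prop) : Prop :=
  exists E : equation -> Prop,
    forall A, K A <-> (forall e, E e -> satisfies_eq A e).

Definition generated_variety (K : mvstruct -> Prop) (A : mvstruct) : Prop :=
  forall W : mvstruct -> Prop,
    variety W -> (forall B, K B -> W B) -> W A.

(* forall x_1 ... x_n, exists! z_1 ... z_m, /\_(i < k) s_i(x, z) = t_i(x, z);
   [inl] tags the x variables and [inr] the z variables. *)
Record efd := Efd {
  efd_n : nat;
  efd_m : nat;
  efd_k : nat;
  efd_m_gt0 : 0 < efd_m;
  efd_lhs : 'I_efd_k -> term ('I_efd_n + 'I_efd_m);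
  efd_rhs : 'I_efd_k -> term ('I_efd_n + 'I_efd_m)
}.

Definition valuation (A : Type) (n m : nat) (x : n.-tuple A) (z : m.-tuple A)
    (i : 'I_n + 'I_m) : A :=
  match i with inl j => tnth x j | inr j => tnth z j end.

(* [exists!] ranges over whole tuples z: it is joint uniqueness. *)
Definition satisfies (A : mvstruct) (phi : efd) : Prop :=
  forall x : (efd_n phi).-tuple A, exists! z : (efd_m phi).-tuple A,
    forall i : 'I_(efd_k phi),
      eval (valuation x z) (efd_lhs i) = eval (valuation x z) (efd_rhs i).

Definition epsilon (k : nat) : efd :=
  @Efd 1 1 1 isT (fun=> mv_t k (Var (inr ord0))) (fun=> Var (inl ord0)).

(* Sentences are compared through their classes of models. *)
Definition equivalent_in (K phi psi : mvstruct -> Prop) : Prop :=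
  forall A, K A -> (phi A <-> psi A).

(* Main.v *)
(* Every algebra of V(P) is a subdirect product of chains in which each element is
   an infinitesimal or the negation of one.  An EFD-sentence that holds in all chain
   quotients of an algebra holds in the algebra: uniqueness is clear, and solutions
   modulo two ideals are glued by the Chinese remainder theorem, so that an ideal
   maximal among those without solution would be prime.

   In a chain, fixing for each variable whether it is infinitesimal or not (the
   signs of z are determined by those of x, since the two-element algebra is a
   model) turns the system into piecewise linear equations between infinitesimals.
   The signs taken by finitely many integer linear forms on a totally ordered group
   are also taken at an integer point.  So if some non-Boolean algebra of V(P)
   satisfies the sentence, the solution over the nonnegative rationals is unique and
   exists.  The forms vanishing at a solution determine it, hence it is given by
   finitely many rational linear maps.  Let k be the product of the reduced
   denominators of its values at integer points: chain quotients of models are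
   k-divisible by Bezout, and conversely k-divisible chains are models.  This
   divisibility is what epsilon_k expresses.  If there is no such algebra, the
   models are the Boolean algebras. *)

From HB Require Import structures.
Require Import Defs.
From mathcomp Require Import all_boot all_order all_algebra.
From mathcomp Require Import boolp classical_sets.
From mathcomp Require Import zify.

Set Implicit Arguments.
Unset Strict Implicit.
Unset Printing Implicit Defensive.

(** No ordered group is ever constructed. The infinitesimals of a chain serve as its positive cone:
    they add without truncation, so an integer form in finitely many of them is handled by moving
    its negative part to the other side. Terms are evaluated symbolically, with an oracle telling
    which forms are nonnegative. The resulting test of the system mentions no algebra and consults
    only forms with bounded coefficients, so it passes between chains and integer points. The
    obstacle is uniqueness: a quotient of a model visibly inherits only the existence of solutions.
    Hence uniqueness is read off once, inside a non-Boolean model, at multiples of the meet of some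
    x with its negation. It becomes a statement about integer solutions and from there holds in
    every chain. The number k is built from denominators of values and not of the linear maps,
    because only the former are forced on models. That they clear the matrix entries too is seen by
    comparing a generic point with its neighbours. *)

Local Open Scope mv_scope.

(** * Arithmetic of MV-algebras *)

Section Arithmetic.
Variable A : mvstruct.
Hypothesis hA : mv_algebra A.
Implicit Types x y z u v w : A.

Let addA x y z : x + (y + z) = (x + y) + z := mv_addA hA x y z.
Let addC x y : x + y = y + x := mv_addC hA x y.
Let addx0 x : x + 0 = x := mv_addx0 hA x.
Let negK x : ~` (~` x) = x := mv_negK hA x.
Let addx1 x : x + ~` 0 = ~` 0 := mv_addx1 hA x.

Lemma mv_add0x x : 0 + x = x. Proof. by rewrite addC addx0. Qed.
Lemma mv_add1x x : ~` 0 + x = ~` 0. Proof. by rewrite addC addx1. Qed.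

Lemma mv_addACA x y z w : (x + y) + (z + w) = (x + z) + (y + w).
Proof. by rewrite -!addA (addA y) (addC y) -(addA z). Qed.

Lemma mv_addNx x : ~` x + x = ~` 0.
Proof.
have := mv_joinC hA x (~` 0).
by rewrite addx1 negK mv_add0x => <-.
Qed.

Lemma mv_addxN x : x + ~` x = ~` 0. Proof. by rewrite addC mv_addNx. Qed.

Lemma mv_leP x y : mv_le x y <-> ~` x + y = ~` 0.
Proof.
rewrite /mv_le /mv_join; split=> [<-|->]; last by rewrite negK mv_add0x.
by rewrite (mv_joinC hA) addA [~` x + _]addC -addA mv_addNx addx1.
Qed.

Lemma mv_le_refl x : mv_le x x. Proof. by apply/mv_leP; exact: mv_addNx. Qed.

Lemma mv_le_anti x y : mv_le x y -> mv_le y x -> x = y.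
Proof. by rewrite /mv_le /mv_join => h <-; rewrite (mv_joinC hA) h. Qed.

Lemma mv_le_addr x y : mv_le x (x + y).
Proof. by apply/mv_leP; rewrite addA mv_addNx mv_add1x. Qed.

Lemma mv_le_addl x y : mv_le x (y + x).
Proof. by rewrite addC; exact: mv_le_addr. Qed.

Lemma mv_le_ex x y : mv_le x y -> exists z, y = x + z.
Proof.
move=> h; exists (~` (~` y + x)).
by rewrite addC -(mv_joinC hA); move: h; rewrite /mv_le /mv_join.
Qed.

Lemma mv_le_trans y x z : mv_le x y -> mv_le y z -> mv_le x z.
Proof.
by move=> /mv_le_ex [u ->] /mv_le_ex [v ->]; rewrite -addA; exact: mv_le_addr.
Qed.

Lemma mv_le_add x y z w : mv_le x y -> mv_le z w -> mv_le (x + z) (y + w).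
Proof.
move=> /mv_le_ex [u ->] /mv_le_ex [v ->].
by rewrite mv_addACA; exact: mv_le_addr.
Qed.

Lemma mv_le_neg x y : mv_le x y -> mv_le (~` y) (~` x).
Proof. by move=> /mv_leP h; apply/mv_leP; rewrite negK addC. Qed.

Lemma mv_le0x x : mv_le 0 x. Proof. by apply/mv_leP; exact: mv_add1x. Qed.
Lemma mv_lex1 x : mv_le x (~` 0). Proof. by apply/mv_leP; exact: addx1. Qed.
Lemma mv_lex0 x : mv_le x 0 -> x = 0.
Proof. by move=> h; apply: mv_le_anti h _; exact: mv_le0x. Qed.

Definition mv_sub x y : A := ~` (~` x + y).

(** Residuation: truncated subtraction is adjoint to addition. The least upper bounds and the
    distributivity of addition over meets come from this adjunction. *)
Lemma mv_subP x y z : mv_le (mv_sub x y) z <-> mv_le x (z + y).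
Proof. by rewrite !mv_leP /mv_sub negK -addA (addC y). Qed.

Lemma mv_sub0P x y : mv_sub x y = 0 <-> mv_le x y.
Proof.
split=> [h|/mv_leP h]; last by rewrite /mv_sub h negK.
by have /mv_subP := mv_le_refl (mv_sub x y); rewrite {1}h mv_add0x.
Qed.

Lemma mv_sub_le x y : mv_le (mv_sub x y) x.
Proof. by apply/mv_subP; exact: mv_le_addr. Qed.

Lemma mv_subx0 x : mv_sub x 0 = x.
Proof. by rewrite /mv_sub addx0 negK. Qed.

Lemma mv_subK x y : mv_le y x -> mv_sub x y + y = x.
Proof. by rewrite /mv_le /mv_join (mv_joinC hA). Qed.

Lemma mv_le_subD x y : mv_le x (mv_sub x y + y).
Proof. by apply/mv_subP; exact: mv_le_refl. Qed.

Lemma mv_joinCE x y : mv_join x y = mv_join y x.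
Proof. exact: (mv_joinC hA). Qed.

Lemma mv_le_joinr x y : mv_le y (mv_join x y).
Proof. exact: mv_le_addl. Qed.
Lemma mv_le_joinl x y : mv_le x (mv_join x y).
Proof. by rewrite mv_joinCE; exact: mv_le_joinr. Qed.

Lemma mv_join_lub x y z : mv_le x z -> mv_le y z -> mv_le (mv_join x y) z.
Proof.
move=> xz yz; rewrite -(mv_subK yz) -/(mv_sub x y).
apply: mv_le_add (mv_le_refl _); apply/mv_subP; rewrite mv_subK //.
Qed.

Lemma mv_meet_lel x y : mv_le (mv_meet x y) x.
Proof. by rewrite -{2}[x]negK; apply: mv_le_neg; exact: mv_le_joinl. Qed.
Lemma mv_meet_ler x y : mv_le (mv_meet x y) y.
Proof. by rewrite -{2}[y]negK; apply: mv_le_neg; exact: mv_le_joinr. Qed.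
Lemma mv_meet_glb x y z : mv_le z x -> mv_le z y -> mv_le z (mv_meet x y).
Proof.
move=> zx zy; rewrite -[z]negK; apply: mv_le_neg.
by apply: mv_join_lub; apply: mv_le_neg.
Qed.

Lemma mv_meet_idl x y : mv_le x y -> mv_meet x y = x.
Proof.
move=> xy; apply: mv_le_anti; first exact: mv_meet_lel.
by apply: mv_meet_glb => //; exact: mv_le_refl.
Qed.

Lemma mv_meet_idr x y : mv_le y x -> mv_meet x y = y.
Proof.
move=> xy; apply: mv_le_anti; first exact: mv_meet_ler.
by apply: mv_meet_glb => //; exact: mv_le_refl.
Qed.

Lemma mv_join_idl x y : mv_le y x -> mv_join x y = x.
Proof. by rewrite mv_joinCE. Qed.

Lemma mv_add_meetr_le x y z w :
  mv_le w (x + y) -> mv_le w (x + z) -> mv_le w (x + mv_meet y z).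
Proof.
move=> h1 h2; rewrite addC; apply/mv_subP.
by apply: mv_meet_glb; apply/mv_subP; rewrite addC.
Qed.

Lemma mv_meetDr_le x y z : mv_le (mv_meet x (y + z)) (mv_meet x y + mv_meet x z).
Proof.
apply: mv_add_meetr_le.
  by apply: mv_le_trans (mv_meet_lel _ _) _; exact: mv_le_addl.
rewrite (addC (mv_meet x y)); apply: mv_add_meetr_le.
  by apply: mv_le_trans (mv_meet_lel _ _) _; exact: mv_le_addl.
by rewrite (addC z); exact: mv_meet_ler.
Qed.

Lemma mv_meetC x y : mv_meet x y = mv_meet y x.
Proof. by rewrite /mv_meet mv_joinCE. Qed.

Lemma mv_meet_eq0Dr x y z :
  mv_meet x y = 0 -> mv_meet x z = 0 -> mv_meet x (y + z) = 0.
Proof.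
by move=> h1 h2; apply: mv_lex0; have := mv_meetDr_le x y z; rewrite h1 h2 addx0.
Qed.

Lemma mv_mulE x y : x * y = mv_sub x (~` y). Proof. by []. Qed.
Lemma mv_mulC x y : x * y = y * x. Proof. by rewrite /mv_mul addC. Qed.
Lemma mv_mulA x y z : x * (y * z) = x * y * z.
Proof. by rewrite /mv_mul !negK addA. Qed.
Lemma mv_mul0P x y : x * y = 0 <-> mv_le x (~` y).
Proof. by rewrite mv_mulE mv_sub0P. Qed.
Lemma mv_meetE x y : mv_meet x y = x * (~` x + y).
Proof.
by rewrite /mv_meet /mv_mul (mv_joinCE (~` x)) /mv_join negK addC (addC y).
Qed.

(** Prelinearity. Rewriting meets by [mv_meetE] regroups the left side into a product with factors
    [~x] and [y * (~y + ~w)]. The latter is the meet of [y] and [~w], hence below [~w] and so below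
    [x], which makes the product vanish. *)
Lemma mv_sub_disjoint x y : mv_meet (mv_sub x y) (mv_sub y x) = 0.
Proof.
set w := ~` x + mv_sub y x.
have -> : mv_meet (mv_sub x y) (mv_sub y x) = x * (~` y * (y + w)).
  rewrite mv_meetE mv_mulA {2}/mv_sub negK /w (addA y) (addC y).
  by congr (_ * _); rewrite /mv_mul negK.
have -> : ~` y * (y + w) = w * (~` w + ~` y).
  by rewrite -mv_meetE mv_meetC mv_meetE negK.
have xw : x * w = mv_sub y x * (~` (mv_sub y x) + x).
  by rewrite -mv_meetE mv_meetC mv_meetE.
rewrite mv_mulA xw.
have -> : mv_sub y x = ~` x * y by rewrite /mv_mul /mv_sub negK addC.
rewrite -!mv_mulA mv_mulC; apply/mv_mul0P.
apply: mv_le_trans (_ : mv_le (y * (~` y + ~` w)) _).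
  rewrite mv_mulA [y * _]mv_mulC -mv_mulA (addC (~` w)) mv_mulC.
  exact: mv_sub_le.
rewrite -mv_meetE; apply: mv_le_trans (mv_meet_ler _ _) _.
by apply: mv_le_neg; exact: mv_le_addr.
Qed.

(** Chang's distance: it turns an equation into a statement about one element, and membership of
    that element in an ideal into a congruence. *)
Definition mv_dist x y : A := mv_sub x y + mv_sub y x.

Lemma mv_distC x y : mv_dist x y = mv_dist y x.
Proof. exact: addC. Qed.

Lemma mv_dist0P x y : mv_dist x y = 0 <-> x = y.
Proof.
split=> [h|->]; last first.
  by have /mv_sub0P h := mv_le_refl y; rewrite /mv_dist h addx0.
by apply: mv_le_anti; apply/mv_sub0P; apply: mv_lex0; rewrite -h;
  [exact: mv_le_addr|exact: mv_le_addl].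
Qed.

Lemma mv_sub_triangle y x z : mv_le (mv_sub x z) (mv_sub x y + mv_sub y z).
Proof.
apply/mv_subP; rewrite -addA; apply: mv_le_trans (mv_le_subD x y) _.
by apply: mv_le_add (mv_le_subD y z); exact: mv_le_refl.
Qed.

Lemma mv_dist_triangle y x z : mv_le (mv_dist x z) (mv_dist x y + mv_dist y z).
Proof.
rewrite /mv_dist mv_addACA; apply: mv_le_add; first exact: mv_sub_triangle.
by rewrite addC; exact: mv_sub_triangle.
Qed.

Lemma mv_dist_neg x y : mv_dist (~` x) (~` y) = mv_dist x y.
Proof. by rewrite /mv_dist /mv_sub !negK [y + _]addC [x + _]addC addC. Qed.

Lemma mv_sub_add x y z w : mv_le (mv_sub (x + y) (z + w)) (mv_sub x z + mv_sub y w).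
Proof.
by apply/mv_subP; rewrite mv_addACA; apply: mv_le_add; exact: mv_le_subD.
Qed.

Lemma mv_dist_add x y z w :
  mv_le (mv_dist (x + y) (z + w)) (mv_dist x z + mv_dist y w).
Proof. by rewrite /mv_dist mv_addACA; apply: mv_le_add; exact: mv_sub_add. Qed.

Lemma mv_natS x k : x *+ k.+1 = x + x *+ k.
Proof. by case: k => [|k] //; rewrite /mv_nat /= addx0. Qed.

Lemma mv_natD x k l : x *+ (k + l)%N = x *+ k + x *+ l.
Proof. by elim: k => [|k IH]; rewrite ?mv_add0x // addSn !mv_natS IH addA. Qed.

Lemma mv_natM x k l : x *+ (k * l)%N = (x *+ l) *+ k.
Proof. by elim: k => [|k IH] //; rewrite mulSn mv_natD mv_natS IH. Qed.

Lemma mv_nat0x k : 0 *+ k = 0 :> A.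
Proof. by elim: k => [|k IH] //; rewrite mv_natS IH addx0. Qed.

Lemma mv_natDl x y k : (x + y) *+ k = x *+ k + y *+ k.
Proof. by elim: k => [|k IH]; rewrite ?addx0 // !mv_natS IH mv_addACA. Qed.

Lemma mv_expE x k : x ^+ k = ~` ((~` x) *+ k).
Proof.
case: k => [|k] //; elim: k => [|k IH]; first by rewrite /mv_nat /= negK.
by rewrite mv_natS -[x ^+ k.+2]/(x * x ^+ k.+1) IH /mv_mul negK.
Qed.

End Arithmetic.

(** * Ideals and quotients that are chains *)

Record mv_hom (A B : mvstruct) (f : A -> B) : Prop := MvHom {
  mv_homD : forall x y : A, f (x + y) = f x + f y;
  mv_homN : forall x : A, f (~` x) = ~` (f x);
  mv_hom0 : f 0 = 0
}.

Definition onto (A B : Type) (f : A -> B) : Prop := forall b, exists a, f a = b.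

Lemma hom_eval (A B : mvstruct) (f : A -> B) (V : Type) (v : V -> A) (w : V -> B)
    (t : term V) :
  mv_hom f -> (forall i, f (v i) = w i) -> f (eval v t) = eval w t.
Proof.
move=> hf vw; elim: t => [i||t IH|s IHs t IHt] /=.
- exact: vw.
- exact: mv_hom0 hf.
- by rewrite (mv_homN hf) IH.
- by rewrite (mv_homD hf) IHs IHt.
Qed.

Section HomDerived.
Variables (A B : mvstruct) (f : A -> B).
Hypothesis hf : mv_hom f.
Implicit Types x y : A.

Lemma hom_sub x y : f (mv_sub x y) = mv_sub (f x) (f y).
Proof. by rewrite /mv_sub !(mv_homN hf, mv_homD hf). Qed.

Lemma hom_dist x y : f (mv_dist x y) = mv_dist (f x) (f y).
Proof. by rewrite /mv_dist (mv_homD hf) !hom_sub. Qed.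

Lemma hom_mul x y : f (x * y) = f x * f y.
Proof. by rewrite /mv_mul !(mv_homN hf, mv_homD hf). Qed.

Lemma hom_join x y : f (mv_join x y) = mv_join (f x) (f y).
Proof. by rewrite /mv_join !(mv_homN hf, mv_homD hf). Qed.

Lemma hom_meet x y : f (mv_meet x y) = mv_meet (f x) (f y).
Proof. by rewrite /mv_meet (mv_homN hf) hom_join !(mv_homN hf). Qed.

Lemma hom_nat x k : f (x *+ k) = f x *+ k.
Proof.
case: k => [|k]; first exact: mv_hom0 hf.
elim: k => [|k IH] //; rewrite -[x *+ k.+2]/(x + x *+ k.+1) (mv_homD hf) IH.
by [].
Qed.

Lemma hom_le x y : mv_le x y -> mv_le (f x) (f y).
Proof. by rewrite /mv_le -hom_join => ->. Qed.

End HomDerived.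

Section Ideals.
Variable A : mvstruct.
Hypothesis hA : mv_algebra A.
Implicit Types (I J : A -> Prop) (x y a : A).

Lemma ideal0 I : ideal I -> I 0.
Proof. by case=> -[x Ix] dn _; exact: dn (mv_le0x hA x) Ix. Qed.

Lemma ideal_zero : ideal (fun x => x = 0).
Proof.
split; first by exists 0.
  by move=> x y xy y0; rewrite y0 in xy; exact: mv_lex0.
by move=> x y -> ->; exact: mv_addx0.
Qed.

Lemma ideal_kernel (B : mvstruct) (f : A -> B) :
  mv_algebra B -> mv_hom f -> ideal (fun x => f x = 0).
Proof.
move=> hB hf; split; first by exists 0; exact: mv_hom0.
  by move=> x y /(hom_le hf) xy y0; rewrite y0 in xy; exact: mv_lex0.
by move=> x y fx fy; rewrite (mv_homD hf) fx fy mv_addx0.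
Qed.

Definition ideal_sum I J x := exists i j, [/\ I i, J j & mv_le x (i + j)].

Lemma ideal_ideal_sum I J : ideal I -> ideal J -> ideal (ideal_sum I J).
Proof.
move=> hI hJ; split.
- by exists 0, 0, 0; split; [exact: ideal0|exact: ideal0|exact: mv_le0x].
- move=> x y xy [i [j [Ii Jj yij]]]; exists i, j; split=> //.
  exact: mv_le_trans xy yij.
- move=> x y [i [j [Ii Jj xij]]] [i' [j' [Ii' Jj' yij]]].
  exists (i + i'), (j + j'); split; try exact: ideal_add.
  by rewrite mv_addACA //; exact: mv_le_add.
Qed.

Lemma ideal_suml I J x : ideal J -> I x -> ideal_sum I J x.
Proof.
by move=> hJ Ix; exists x, 0; split=> //; [exact: ideal0|exact: mv_le_addr].
Qed.

Lemma ideal_sumr I J x : ideal I -> J x -> ideal_sum I J x.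
Proof.
by move=> hI Jx; exists 0, x; split=> //; [exact: ideal0|exact: mv_le_addl].
Qed.

Definition principal a x := exists k, mv_le x (a *+ k).

Lemma ideal_principal a : ideal (principal a).
Proof.
split; first by exists 0, 0%N; exact: mv_le0x.
  by move=> x y xy [k yk]; exists k; exact: mv_le_trans xy yk.
move=> x y [k xk] [l yl]; exists (k + l)%N.
by rewrite mv_natD //; exact: mv_le_add.
Qed.

Lemma principal_refl a : principal a a.
Proof. by exists 1%N; exact: mv_le_refl. Qed.

Lemma mv_meet_nat0 a b k l : mv_meet a b = 0 -> mv_meet (a *+ k) (b *+ l) = 0.
Proof.
have step (u v : A) n : mv_meet u v = 0 -> mv_meet u (v *+ n) = 0.
  move=> uv; elim: n => [|n IH].
    by rewrite mv_meetC // mv_meet_idl //; exact: mv_le0x.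
  by rewrite mv_natS //; exact: mv_meet_eq0Dr.
by move=> ab; apply: (step); rewrite mv_meetC //; apply: (step); rewrite mv_meetC.
Qed.

(** For some s in [I], x lies below both s + ka and s + lb, hence below s plus the meet of ka and
    lb. Multiples of disjoint elements are disjoint, so that meet is 0. *)
Lemma ideal_sum_disjoint I a b x :
  ideal I -> mv_meet a b = 0 ->
  ideal_sum I (principal a) x -> ideal_sum I (principal b) x -> I x.
Proof.
move=> hI ab [i [c [Ii [k ck] xi]]] [j [d [Ij [l dl] xj]]].
have ij : I (i + j) by exact: ideal_add.
apply: ideal_down ij => //; rewrite -[i + j](mv_addx0 hA) -(mv_meet_nat0 k l ab).
by apply: mv_add_meetr_le => //; rewrite -mv_addA //;
  [rewrite (mv_addC hA j)|]; rewrite ?mv_addA //;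
  [apply: mv_le_trans xi _ => //|apply: mv_le_trans xj _ => //];
  [apply: mv_le_trans (_ : mv_le (i + a *+ k) _) => //|
   rewrite -mv_addA //; apply: mv_le_trans (mv_le_addl hA _ i) => //];
  try (by apply: mv_le_add => //; exact: mv_le_refl); exact: mv_le_addr.
Qed.

End Ideals.

Section Quotient.
Variables (A : mvstruct) (I : A -> Prop).
Hypotheses (hA : mv_algebra A) (hI : ideal I).
Implicit Types x y z : A.

Definition cong x y : Prop := I (mv_dist x y).

Lemma cong_refl x : cong x x.
Proof.
by rewrite /cong; have /(mv_dist0P hA) -> := erefl x; exact: (ideal0 hA).
Qed.

Lemma cong_sym x y : cong x y -> cong y x.
Proof. by rewrite /cong mv_distC. Qed.

Lemma cong_trans y x z : cong x y -> cong y z -> cong x z.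
Proof.
move=> xy yz; apply: ideal_down (mv_dist_triangle hA y x z) _ => //.
exact: ideal_add.
Qed.

Lemma cong_add x y z w : cong x z -> cong y w -> cong (x + y) (z + w).
Proof.
move=> xz yw; apply: ideal_down (mv_dist_add hA x y z w) _ => //.
exact: ideal_add.
Qed.

Lemma cong_neg x y : cong x y -> cong (~` x) (~` y).
Proof. by rewrite /cong mv_dist_neg. Qed.

Lemma cong_class x y : cong x y <-> cong x = cong y.
Proof.
split=> [xy|e]; last by rewrite e; exact: cong_refl.
apply/funext => z; apply/propext; split; apply: cong_trans => //.
exact: cong_sym.
Qed.

(** Classes are predicates, so congruent elements have equal classes by extensionality; the
    operations act on chosen representatives. *)
Definition quot_carrier := {c : A -> Prop | exists x, c = cong x}.
Definition quot_pi x : quot_carrier := exist _ (cong x) (ex_intro _ x erefl).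
Definition quot_repr (c : quot_carrier) : A := sval (cid (svalP c)).

Lemma quot_reprK c : quot_pi (quot_repr c) = c.
Proof.
rewrite /quot_pi /quot_repr; case: c => c hc /=.
by case: cid => x /= cx; apply: eq_exist.
Qed.

Lemma quot_piP x y : quot_pi x = quot_pi y <-> cong x y.
Proof.
split=> [e|/cong_class e]; last exact: eq_exist.
by apply/cong_class; have := congr1 sval e.
Qed.

Lemma quot_repr_cong x : cong (quot_repr (quot_pi x)) x.
Proof. by apply/quot_piP; exact: quot_reprK. Qed.

Definition quot : mvstruct := @MvStruct quot_carrier
  (fun c d => quot_pi (quot_repr c + quot_repr d))
  (fun c => quot_pi (~` quot_repr c)) (quot_pi 0).

Lemma quot_pi_hom : @mv_hom A quot quot_pi.
Proof.
split=> //= x; last by apply/quot_piP/cong_neg/cong_sym/quot_repr_cong.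
by move=> y; apply/quot_piP/cong_sym/cong_add; exact: quot_repr_cong.
Qed.

Lemma quot_pi_onto : onto quot_pi.
Proof. by move=> c; exists (quot_repr c); exact: quot_reprK. Qed.

Lemma quot_mv : mv_algebra quot.
Proof.
have D x y : quot_pi (x + y) = (quot_pi x : quot) + quot_pi y := mv_homD quot_pi_hom x y.
have N x : quot_pi (~` x) = ~` (quot_pi x : quot) := mv_homN quot_pi_hom x.
have Z : quot_pi 0 = 0 :> quot by [].
split=> x.
- move=> y z; rewrite -(quot_reprK x) -(quot_reprK y) -(quot_reprK z) -!D.
  by rewrite mv_addA.
- by move=> y; rewrite -(quot_reprK x) -(quot_reprK y) -!D mv_addC.
- by rewrite -(quot_reprK x) -Z -!D mv_addx0.
- by rewrite -(quot_reprK x) -!N mv_negK.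
- have -> : ~` (0 : quot) = quot_pi (~` 0) by rewrite N.
  by rewrite -(quot_reprK x) -D mv_addx1.
- move=> y; rewrite -(quot_reprK x) -(quot_reprK y).
  have joinE a b : quot_pi (~` (~` a + b) + b) =
      ~` (~` (quot_pi a : quot) + quot_pi b) + quot_pi b by rewrite D N D N.
  by rewrite -!joinE (mv_joinC hA).
Qed.

Lemma quot_pi0P x : quot_pi x = 0 :> quot <-> I x.
Proof.
rewrite -[0 : quot]/(quot_pi 0) quot_piP /cong /mv_dist mv_subx0 //.
by have /(mv_sub0P hA) -> := mv_le0x hA x; rewrite mv_addx0.
Qed.

End Quotient.

Section Zorn.
Variable A : mvstruct.
Hypothesis hA : mv_algebra A.
Variable S : (A -> Prop) -> Prop.

Definition chain_closed : Prop := forall F : (A -> Prop) -> Prop,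
  (exists I, F I) -> (forall I, F I -> ideal I /\ S I) ->
  (forall I J, F I -> F J -> (forall x, I x -> J x) \/ (forall x, J x -> I x)) ->
  S (fun x => exists2 I, F I & I x).

(** Zorn's lemma for the ideals in [S] above [I0]. The empty chain is bounded by [I0] itself, so
    [chain_closed] speaks of nonempty families only. *)
Lemma maximal_ideal_for (I0 : A -> Prop) :
  ideal I0 -> S I0 -> chain_closed ->
  exists I, [/\ ideal I, S I, (forall x, I0 x -> I x) &
    forall J, ideal J -> S J -> (forall x, I x -> J x) -> forall x, J x -> I x].
Proof.
move=> hI0 SI0 hch.
pose T := {I : A -> Prop | [/\ ideal I, S I & forall x, I0 x -> I x]}.
have t0 : T by exists I0.
pose R (s t : T) := `[< forall x, sval s x -> sval t x >].
have [| | |[I [hI SI I0I]] Imax] := @ZL_preorder T t0 R.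
- by move=> t; apply/asboolP.
- move=> r s t /asboolP rs /asboolP st; apply/asboolP => x ?.
  by apply: st; exact: rs.
- move=> F totF.
  have [[s0 Fs0]|noF] := pselect (exists s, F s); last first.
    by exists t0 => s Fs; case: noF; exists s.
  pose U x := exists2 I, (exists2 s, F s & sval s = I) & I x.
  have hFtot I J : (exists2 s, F s & sval s = I) -> (exists2 s, F s & sval s = J) ->
      (forall x, I x -> J x) \/ (forall x, J x -> I x).
    move=> [s Fs <-] [t Ft <-].
    by case: (totF s t Fs Ft) => /asboolP; [left|right].
  have hU : ideal U.
    split.
    - by exists 0, (sval s0); [exists s0|apply: ideal0 => //; case: (svalP s0)].
    - move=> x y xy [I [s Fs <-] sy]; exists (sval s); first by exists s.
      by case: (svalP s) => hs _ _; exact: ideal_down xy sy.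
    - move=> x y [I FI Ix] [J FJ Jy].
      case: (hFtot I J FI FJ) => sub.
        exists J => //; case: FJ Jy sub => s Fs <- Jy sub.
        by case: (svalP s) => hs _ _; apply: ideal_add => //; exact: sub.
      exists I => //; case: FI Ix sub => s Fs <- Ix sub.
      by case: (svalP s) => hs _ _; apply: ideal_add => //; exact: sub.
  have SU : S U.
    apply: hch => //; first by exists (sval s0); exists s0.
    by move=> I [s Fs <-]; case: (svalP s).
  have U0 x : I0 x -> U x.
    move=> Ix; exists (sval s0); first by exists s0.
    by case: (svalP s0) => _ _; exact.
  exists (exist _ U (And3 hU SU U0)) => s Fs; apply/asboolP => x sx /=.
  by exists (sval s) => //; exists s.
exists I; split=> // J hJ SJ IJ x Jx.
have I0J y : I0 y -> J y by move=> /I0I /IJ.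
have := Imax (exist _ J (And3 hJ SJ I0J)).
by move=> /(_ (introT (asboolP _) IJ)) /asboolP; exact.
Qed.

End Zorn.

Definition mv_chain (C : mvstruct) : Prop :=
  [/\ mv_algebra C, forall x y : C, mv_le x y \/ mv_le y x & 0 <> ~` 0 :> C].

(* Maximality of an ideal outside a family that is closed under intersections
   makes it prime, because x - y and y - x have meet 0. *)
Lemma chain_quotient (A : mvstruct) (hA : mv_algebra A) (S : (A -> Prop) -> Prop)
    (I0 : A -> Prop) :
  ideal I0 -> S I0 -> chain_closed S -> (forall I, ideal I -> S I -> ~ I (~` 0)) ->
  (forall I J K, ideal I -> ideal J -> ideal K ->
     (forall x, I x -> J x -> K x) -> S K -> S I \/ S J) ->
  exists (C : mvstruct) (p : A -> C), [/\ mv_chain C, mv_hom p, onto p,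
    (forall x, I0 x -> p x = 0) & S (fun x => p x = 0)].
Proof.
move=> hI0 SI0 Sch S1 Smeet.
have [P [hP SP I0P Pmax]] := maximal_ideal_for hA hI0 SI0 Sch.
exists (quot P), (quot_pi P); split.
- split; first exact: quot_mv.
    move=> c d; have [x <-] := quot_pi_onto c; have [y <-] := quot_pi_onto d.
    have hom := quot_pi_hom hA hP; pose Q a := ideal_sum P (principal a).
    have hQ a : ideal (Q a).
      by apply: ideal_ideal_sum => //; exact: ideal_principal.
    have QP a : S (Q a) -> P a.
      move=> SQ; apply: (Pmax (Q a)) => // [z Pz|].
        by apply: ideal_suml => //; exact: ideal_principal.
      by apply: ideal_sumr => //; exact: principal_refl.
    have := Smeet (Q (mv_sub x y)) (Q (mv_sub y x)) P.
    case=> //.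
    + by move=> z; apply: ideal_sum_disjoint => //; exact: mv_sub_disjoint.
    + move=> /QP /(quot_pi0P hA hP); rewrite (hom_sub hom).
      by move=> /(mv_sub0P (quot_mv hA hP)); left.
    + move=> /QP /(quot_pi0P hA hP); rewrite (hom_sub hom).
      by move=> /(mv_sub0P (quot_mv hA hP)); right.
  have hom := quot_pi_hom hA hP.
  rewrite -(mv_hom0 hom) -(mv_homN hom) => /esym e.
  by apply: (S1 P hP SP); apply/(quot_pi0P hA hP).
- exact: quot_pi_hom.
- exact: quot_pi_onto.
- by move=> x /I0P Px; apply/quot_pi0P.
- suff -> : (fun x => quot_pi P x = 0 :> quot P) = P by [].
  by apply/funext => x; apply/propext; exact: quot_pi0P.
Qed.

(** If two ideals contain [a], so does every ideal above their intersection; hence maximality among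
    the ideals avoiding [a] yields a chain. Used with [a] a distance, it makes equations testable in
    chain quotients. *)
Lemma separating_chain (A : mvstruct) (hA : mv_algebra A) (I : A -> Prop) (a : A) :
  ideal I -> ~ I a ->
  exists (C : mvstruct) (p : A -> C), [/\ mv_chain C, mv_hom p, onto p,
    (forall x, I x -> p x = 0) & p a <> 0].
Proof.
move=> hI Ia.
have [||||C [p [hC hp sp Ip [pa _]]]] := @chain_quotient A hA
  (fun J => ~ J a /\ ~ J (~` 0)) I hI.
- split=> // I1; apply: Ia; apply: ideal_down I1 => //; exact: mv_lex1.
- move=> F [J FJ] hF tot; split=> -[K FK Ka].
    by case: (hF _ FK) => _ [].
  by case: (hF _ FK) => _ [].
- by move=> J _ [].
- move=> J K L hJ hK hL JKL [La L1].
  have [Ja|Ja] := pselect (J a).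
    right; split=> [Ka|K1]; first by apply: La; exact: JKL.
    apply: La; apply: JKL => //; apply: ideal_down K1 => //; exact: mv_lex1.
  left; split=> // J1; apply: Ja; apply: ideal_down J1 => //; exact: mv_lex1.
by exists C, p.
Qed.

Lemma separating_chain_eq (A : mvstruct) (hA : mv_algebra A) (x y : A) :
  x <> y -> exists (C : mvstruct) (p : A -> C),
    [/\ mv_chain C, mv_hom p, onto p & p x <> p y].
Proof.
move=> xy; have [|C [p [hC hp sp _ pd]]] :=
  @separating_chain A hA _ (mv_dist x y) (ideal_zero hA).
  by move=> /(mv_dist0P hA).
exists C, p; split=> // e; apply: pd.
by rewrite hom_dist // e; case: hC => hC _ _; exact/(mv_dist0P hC).
Qed.

(** * Gluing solutions from the chains *)

Section Solutions.
Variable phi : efd.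
Implicit Types A B : mvstruct.

Definition sol A (v : 'I_(efd_n phi) + 'I_(efd_m phi) -> A) : Prop :=
  forall i : 'I_(efd_k phi), eval v (efd_lhs i) = eval v (efd_rhs i).

Lemma sol_hom A B (f : A -> B) v w :
  mv_hom f -> (forall i, f (v i) = w i) -> sol v -> sol w.
Proof. by move=> hf vw sv i; rewrite -!(hom_eval _ hf vw) sv. Qed.

Lemma valuation_map A B (f : A -> B) (x : (efd_n phi).-tuple A)
    (z : (efd_m phi).-tuple A) i :
  f (valuation x z i) = valuation (map_tuple f x) (map_tuple f z) i.
Proof. by case: i => i /=; rewrite tnth_map. Qed.

Lemma sol_map A B (f : A -> B) (x : (efd_n phi).-tuple A) z :
  mv_hom f -> sol (valuation x z) -> sol (valuation (map_tuple f x) (map_tuple f z)).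
Proof. by move=> hf; apply: (sol_hom hf) => i; exact: valuation_map. Qed.

Lemma onto_tuple (T U : Type) n (f : T -> U) (y : n.-tuple U) :
  onto f -> exists x : n.-tuple T, map_tuple f x = y.
Proof.
move=> /choice [g gK]; exists (map_tuple g y).
by apply: eq_from_tnth => i; rewrite !tnth_map gK.
Qed.

(** Let p + r bound the distance, with p in [I] and r in [J]. The witness clamps b to the interval
    from a - p to a + p. Modulo [I] this interval shrinks to a; modulo [J] the distance is at most
    p, so b already lies inside. *)
Lemma cong_crt A (hA : mv_algebra A) (I J : A -> Prop) (a b : A) :
  ideal I -> ideal J -> ideal_sum I J (mv_dist a b) ->
  exists w, cong I w a /\ cong J w b.
Proof.
move=> hI hJ [p [r [Ip Jr dpr]]].
exists (mv_join (mv_meet b (a + p)) (mv_sub a p)); split.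
  apply/(quot_piP hA hI); have hom := quot_pi_hom hA hI.
  have hQ := quot_mv hA hI.
  rewrite (hom_join hom) (hom_meet hom) (hom_sub hom) (mv_homD hom).
  have /(quot_pi0P hA hI) -> := Ip.
  by rewrite mv_addx0 // mv_subx0 //; apply: (mv_meet_ler hQ).
apply/(quot_piP hA hJ); have hom := quot_pi_hom hA hJ.
have hQ := quot_mv hA hJ.
have := hom_le hom dpr; rewrite (mv_homD hom); have /(quot_pi0P hA hJ) -> := Jr.
rewrite mv_addx0 // (hom_dist hom) => dp.
have ab : mv_le (mv_sub (quot_pi J a : quot J) (quot_pi J b)) (quot_pi J p).
  by apply: mv_le_trans dp => //; exact: mv_le_addr.
have ba : mv_le (mv_sub (quot_pi J b : quot J) (quot_pi J a)) (quot_pi J p).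
  by apply: mv_le_trans dp => //; exact: mv_le_addl.
rewrite (hom_join hom) (hom_meet hom) (hom_sub hom) (mv_homD hom).
rewrite (mv_meet_idl hQ); last by move/(mv_subP hQ): ba; rewrite (mv_addC hQ).
apply: (mv_join_idl hQ); apply/(mv_subP hQ).
by move/(mv_subP hQ): ab; rewrite (mv_addC hQ).
Qed.

Lemma satisfies_unique A : satisfies A phi ->
  forall (x : (efd_n phi).-tuple A) z z',
  sol (valuation x z) -> sol (valuation x z') -> z = z'.
Proof. by move=> h x z z' s s'; have [w [_ u]] := h x; rewrite -(u z) // -(u z'). Qed.

(* Solutions modulo two ideals agree modulo their sum, by uniqueness in the
   chains, so the Chinese remainder theorem glues them to a solution modulo the
   intersection; an ideal maximal among those without solution is then prime. *)
Lemma satisfies_of_chains A (hA : mv_algebra A) :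
  (forall (C : mvstruct) (p : A -> C),
     mv_chain C -> mv_hom p -> onto p -> satisfies C phi) ->
  satisfies A phi.
Proof.
move=> hC x.
suff [z sz] : exists z, sol (valuation x z).
  exists z; split=> // z' sz'; apply: eq_from_tnth => j.
  case: (pselect (tnth z j = tnth z' j)) => // /(separating_chain_eq hA).
  move=> [C [p [cC hp sp []]]].
  rewrite -(tnth_map p z j) -(tnth_map p z' j); congr (tnth _ j).
  by apply: (satisfies_unique (hC C p cC hp sp)); apply: sol_map => //.
pose solmod (I : A -> Prop) z := forall i : 'I_(efd_k phi),
  cong I (eval (valuation x z) (efd_lhs i)) (eval (valuation x z) (efd_rhs i)).
apply: contrapT => nosol.
have [||||C [p [cC hp sp _ []]]] := @chain_quotient A hA
  (fun I => ~ exists z, solmod I z) _ (ideal_zero hA).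
- move=> [z sz]; apply: nosol; exists z => i.
  by have /(mv_dist0P hA) := sz i.
- move=> F [I0 FI0] hF tot [z sz].
  (* The system is finite, so a single ideal of the chain already contains all the distances. *)
  have [I FI sI] : exists2 I, F I & forall i, i \in enum 'I_(efd_k phi) ->
      cong I (eval (valuation x z) (efd_lhs i)) (eval (valuation x z) (efd_rhs i)).
    elim: (enum _) => [|i s [I FI IH]]; first by exists I0.
    have [J FJ Ji] := sz i; case: (tot I J FI FJ) => sub.
      by exists J => // j; rewrite inE => /predU1P[->//|/IH]; exact: sub.
    by exists I => // j; rewrite inE => /predU1P[->//|/IH //]; exact: sub.
  by case: (hF I FI) => _; apply; exists z => i; apply: sI; rewrite mem_enum.
- move=> I hI nI I1; apply: nI; exists (nseq_tuple _ 0) => i.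
  by apply: ideal_down I1; [|exact: mv_lex1].
- move=> I J K hI hJ hK IJK nK; apply: contrapT => /not_orP [].
  move=> /contrapT [z1 s1] /contrapT [z2 s2]; apply: nK.
  have hS := ideal_ideal_sum hA hI hJ.
  have agree j : exists w, cong I w (tnth z1 j) /\ cong J w (tnth z2 j).
    apply: cong_crt => //; apply: contrapT => /(separating_chain hA hS).
    move=> [C [p [cC hp sp p0 []]]]; rewrite hom_dist //.
    rewrite -(tnth_map p z1 j) -(tnth_map p z2 j).
    have hCmv : mv_algebra C by case: cC.
    apply/(mv_dist0P hCmv); congr (tnth _ j).
    apply: (satisfies_unique (hC C p cC hp sp) (x := map_tuple p x)) => i.
      rewrite -!(hom_eval _ hp (valuation_map p _ _)).
      apply/(mv_dist0P hCmv); rewrite -hom_dist //; apply: p0.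
      by apply: ideal_suml => //; exact: s1.
    rewrite -!(hom_eval _ hp (valuation_map p _ _)).
    apply/(mv_dist0P hCmv); rewrite -hom_dist //; apply: p0.
    by apply: ideal_sumr => //; exact: s2.
  have [w hw] := choice agree.
  have transport (L : A -> Prop) z' : ideal L -> solmod L z' ->
      (forall j, cong L (w j) (tnth z' j)) -> solmod L (mktuple w).
    move=> hL sL wz i; have hom := quot_pi_hom hA hL.
    have e j : quot_pi L (valuation x (mktuple w) j) = quot_pi L (valuation x z' j).
      by case: j => j //=; rewrite tnth_mktuple; apply/quot_piP.
    apply/(quot_piP hA hL).
    rewrite (hom_eval _ hom e) (hom_eval _ hom e) -!(hom_eval _ hom (fun=> erefl)).
    by apply/(quot_piP hA hL).
  exists (mktuple w) => i; apply: IJK.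
    by apply: (transport I z1) => // j; case: (hw j).
  by apply: (transport J z2) => // j; case: (hw j).
have [z sz] : exists z, sol (valuation (map_tuple p x) z).
  by have [z [sz _]] := hC C p cC hp sp (map_tuple p x); exists z.
have hCmv : mv_algebra C by case: cC.
have [z0 zE] := onto_tuple z sp; rewrite -zE in sz.
exists z0 => i; rewrite /cong hom_dist //; apply/(mv_dist0P hCmv).
by rewrite !(hom_eval _ hp (valuation_map p _ _)); exact: sz.
Qed.

End Solutions.

Lemma generated_variety_eq (K : mvstruct -> Prop) (A : mvstruct) (e : equation) :
  generated_variety K A -> (forall B, K B -> satisfies_eq B e) -> satisfies_eq A e.
Proof.
move=> hA he; apply: (hA (fun B => satisfies_eq B e)) => //.
exists (fun e' => e' = e) => B; split=> [h e' ->//|]; exact.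
Qed.

(** * Equations of the variety generated by perfect algebras *)

Section Perfect.
Variable A : mvstruct.
Hypothesis hA : perfect A.
Let mvA : mv_algebra A. Proof. by case: hA. Qed.

Lemma mv_radD (x y : A) : mv_rad x -> mv_rad y -> mv_rad (x + y).
Proof. by move=> hx hy I mI; apply: ideal_add (hx I mI) (hy I mI); case: mI. Qed.

Lemma mv_chain_add_neq (C : mvstruct) (x : C) :
  mv_chain C -> x * x <> 0 -> x + x = ~` 0.
Proof.
move=> [hC tot _] xx; have : mv_le (~` x) x.
  by case: (tot (~` x) x) => // /(mv_mul0P hC).
by move=> /(mv_leP hC); rewrite mv_negK.
Qed.

(** If the product is not 0, some chain quotient has x + x = 1. A maximal ideal above its kernel
    contains the negation of x + x, and also x from the radical, hence the unit. *)
Lemma mv_rad_mulxx (x : A) : mv_rad x -> x * x = 0.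
Proof.
move=> radx; apply: contrapT => /(separating_chain_eq mvA) [C [p [cC hp sp]]].
rewrite hom_mul // mv_hom0 // => /(mv_chain_add_neq cC) p1.
have hCmv : mv_algebra C by case: cC.
have [|||M [hM M1 kerM Mmax]] := @maximal_ideal_for A mvA (fun J => ~ J (~` 0))
  (fun a => p a = 0).
- exact: ideal_kernel.
- by rewrite (mv_homN hp) (mv_hom0 hp); case: cC => _ _ n01 /esym.
- by move=> F _ hF _ [I FI I1]; case: (hF I FI) => _ [].
have maxM : maximal_ideal M.
  split=> //; first by exists (~` 0).
  move=> J hJ [y Jy] MJ; apply: Mmax => // J1; apply: Jy.
  by apply: ideal_down J1 => //; exact: mv_lex1.
have Mx := radx M maxM; apply: M1.
have -> : ~` 0 = (x + x) + ~` (x + x) by rewrite mv_addxN.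
apply: ideal_add => //; first exact: ideal_add.
by apply: kerM; rewrite (mv_homN hp) (mv_homD hp) p1 mv_negK.
Qed.

(** Both sides vanish on the radical, and replacing x by its negation exchanges them up to negation.
    Besides the MV axioms, this equation is all that is used of the generated variety. *)
Lemma perfect_eq (x : A) : (x * x) + (x * x) = (x + x) * (x + x).
Proof.
have rad_eq (a : A) : mv_rad a -> (a * a) + (a * a) = 0 /\ (a + a) * (a + a) = 0.
  by move=> ra; rewrite (mv_rad_mulxx ra) (mv_rad_mulxx (mv_radD ra ra)) mv_addx0.
have [_ _ /(_ x) [/rad_eq[-> ->]//|[a /rad_eq [e1 e2] ->]]] := hA.
move: e1 e2; rewrite /mv_mul !mv_negK // => e1 e2.
by rewrite -[LHS]mv_negK // e2 -e1.
Qed.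

End Perfect.

(** [x * x = 0] says that x lies below its negation. Closure of such elements under doubling makes
    them an ideal, and every other element is the negation of one. *)
Record pchain (C : mvstruct) : Prop := PChain {
  pchain_chain : mv_chain C;
  pchain_inf : forall x : C, x * x = 0 -> (x + x) * (x + x) = 0
}.

Section GeneratedVariety.
Variable A : mvstruct.
Hypothesis VA : generated_variety perfect A.

Let holds (s t : term nat) :
  (forall B, perfect B -> satisfies_eq B (s, t)) -> forall v : nat -> A,
  eval v s = eval v t.
Proof. exact: (generated_variety_eq VA). Qed.

Lemma generated_variety_mv : mv_algebra A.
Proof.
pose v (x y z : A) n := nth 0 [:: x; y; z] n.
pose X : term nat := Var 0%N; pose Y : term nat := Var 1%N; pose Z : term nat := Var 2%N.
split=> x; last move=> y; try move=> y z.
- have := @holds (X + (Y + Z)) ((X + Y) + Z) _ (v x y z); apply.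
  by move=> B [hB _ _] w; exact: mv_addA.
- move=> y; have := @holds (X + Y) (Y + X) _ (v x y 0); apply.
  by move=> B [hB _ _] w; exact: mv_addC.
- have := @holds (X + 0) X _ (v x 0 0); apply.
  by move=> B [hB _ _] w; exact: mv_addx0.
- have := @holds (~` (~` X)) X _ (v x 0 0); apply.
  by move=> B [hB _ _] w; exact: mv_negK.
- have := @holds (X + ~` 0) (~` 0) _ (v x 0 0); apply.
  by move=> B [hB _ _] w; exact: mv_addx1.
- have := @holds (~` (~` X + Y) + Y) (~` (~` Y + X) + X) _ (v x y 0); apply.
  by move=> B [hB _ _] w; exact: mv_joinC.
Qed.

Lemma generated_variety_eq2 (x : A) : (x * x) + (x * x) = (x + x) * (x + x).
Proof.
pose X : term nat := Var 0%N.
have := @holds ((X * X) + (X * X)) ((X + X) * (X + X)) _ (fun=> x); apply.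
by move=> B hB w; exact: perfect_eq.
Qed.

Lemma pchain_quotient (C : mvstruct) (p : A -> C) :
  mv_chain C -> mv_hom p -> onto p -> pchain C.
Proof.
move=> cC hp sp; split=> // c; have [x <-] := sp c.
rewrite -hom_mul // => e.
rewrite -(mv_homD hp) -hom_mul // -generated_variety_eq2 (mv_homD hp) e.
by case: cC => hC _ _; exact: mv_addx0.
Qed.

End GeneratedVariety.

(** * Infinitesimals of a chain and integer linear forms *)

Section Infinitesimals.
Variable C : mvstruct.
Hypothesis hC : pchain C.
Implicit Types x y z : C.

Lemma pchain_mv : mv_algebra C. Proof. by case: hC => -[]. Qed.
Lemma pchain_total x y : mv_le x y \/ mv_le y x. Proof. by case: hC => -[]. Qed.
Lemma pchain_neq01 : 0 <> ~` 0 :> C. Proof. by case: hC => -[]. Qed.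
Let mvC := pchain_mv.

Definition inf x : Prop := x * x = 0.

Lemma inf0 : inf 0.
Proof. by apply/(mv_mul0P mvC); exact: mv_le0x. Qed.

Lemma inf_le x y : mv_le y x -> inf x -> inf y.
Proof.
move=> yx /(mv_mul0P mvC) xx; apply/(mv_mul0P mvC).
exact: (mv_le_trans mvC yx (mv_le_trans mvC xx (mv_le_neg mvC yx))).
Qed.

Lemma infD x y : inf x -> inf y -> inf (x + y).
Proof.
wlog yx : x y / mv_le y x => [IH ix iy|ix _].
  by case: (pchain_total y x) => h; [|rewrite (mv_addC mvC)]; exact: IH.
apply: inf_le (pchain_inf hC ix).
by apply: mv_le_add => //; exact: mv_le_refl.
Qed.

Lemma inf_nat x k : inf x -> inf (x *+ k).
Proof.
move=> ix; elim: k => [|k IH]; first exact: inf0.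
by rewrite mv_natS //; exact: infD.
Qed.

Lemma inf_or x : inf x \/ inf (~` x).
Proof.
case: (pchain_total x (~` x)) => h; [left|right]; apply/(mv_mul0P mvC) => //.
by rewrite mv_negK.
Qed.

Lemma inf_neg x : inf x -> ~ inf (~` x).
Proof.
move=> ix /(mv_mul0P mvC); rewrite mv_negK // => nx.
have xx : x + x = ~` 0.
  by move/(mv_leP mvC): nx; rewrite mv_negK.
move: (infD ix ix); rewrite xx /inf /mv_mul mv_negK // mv_addx0 // => /esym.
exact: pchain_neq01.
Qed.

Lemma inf_mul x y : inf x -> inf y -> x * y = 0.
Proof.
wlog yx : x y / mv_le y x => [IH ix iy|/(mv_mul0P mvC) ix _].
  by case: (pchain_total y x) => h; [|rewrite (mv_mulC mvC)]; exact: IH.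
apply/(mv_mul0P mvC); exact: (mv_le_trans mvC ix (mv_le_neg mvC yx)).
Qed.

(** Each of two infinitesimals lies below the negation of the other, so their sum is not truncated
    and commutativity of the join turns into cancellation. *)
Lemma inf_addK x y : inf x -> inf y -> mv_sub (y + x) x = y.
Proof.
move=> ix iy; have /(mv_mul0P mvC) := inf_mul ix iy.
rewrite /mv_le /mv_join => e; rewrite -[RHS]mv_negK // -e.
by rewrite /mv_sub (mv_joinC mvC) mv_negK.
Qed.

Lemma inf_addIr x y z : inf x -> inf y -> inf z -> y + x = z + x -> y = z.
Proof. by move=> ix iy iz e; rewrite -(inf_addK ix iy) e inf_addK. Qed.

Lemma inf_add_eq0 x y : x + y = 0 -> x = 0.
Proof. by move=> e; apply: (mv_lex0 mvC); rewrite -e; exact: mv_le_addr. Qed.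

Lemma inf_natI x y k : 0 < k -> inf x -> inf y -> x *+ k = y *+ k -> x = y.
Proof.
move=> k0; wlog xy : x y / mv_le x y => [IH ix iy e|ix iy].
  by case: (pchain_total x y) => h; [|symmetry]; exact: IH.
have iw : inf (mv_sub y x) by apply: inf_le iy; exact: mv_sub_le.
have {1}<- : mv_sub y x + x = y by exact: mv_subK.
rewrite mv_natDl // => /esym; rewrite -{2}[x *+ k](mv_add0x mvC).
move=> /(inf_addIr (inf_nat k ix) (inf_nat k iw) inf0).
by case: k k0 => // k _; rewrite mv_natS // => /inf_add_eq0 /(mv_sub0P mvC) /(mv_le_anti mvC xy).
Qed.

End Infinitesimals.

(** * Total preorders on integer linear forms *)

Section Cones.
Import GRing.Theory Num.Theory.
Local Open Scope ring_scope.

(* The forms that are nonnegative for a total group preorder on [Z^N]. *)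
Record cone N (P : 'rV[int]_N -> Prop) : Prop := Cone {
  coneD : forall l u, P l -> P u -> P (l + u);
  cone_total : forall l, P l \/ P (- l)
}.

Variables (N : nat) (P : 'rV[int]_N -> Prop).
Hypothesis hP : cone P.

Lemma cone0 : P 0.
Proof. by have := cone_total hP 0; rewrite oppr0 => -[]. Qed.

Lemma coneMn l k : P l -> P (l *+ k).
Proof.
move=> Pl; elim: k => [|k IH]; first by rewrite mulr0n; exact: cone0.
by rewrite mulrS; exact: coneD.
Qed.

Lemma coneMn_inv l k : (0 < k)%N -> P (l *+ k) -> P l.
Proof.
case: k => // k _ Plk; case: (cone_total hP l) => // Pnl.
suff -> : l = l *+ k.+1 + (- l) *+ k by apply: coneD => //; exact: coneMn.
by rewrite mulrS mulNrn addrK.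
Qed.

End Cones.

(** * Infinitesimals as values of integer linear forms *)

Section Representation.
Import GRing.Theory Num.Theory.
Variable C : mvstruct.
Hypothesis hC : pchain C.
Let mvC := pchain_mv hC.
Variables (N : nat) (xi : 'I_N -> C).
Hypothesis hxi : forall i, inf (xi i).
Implicit Types (x y : C) (l u : 'rV[int]_N) (a b : 'I_N -> nat).

Let law : Monoid.com_law (0 : C) := HB.pack (@mv_add C)
  (Monoid.isComLaw.Build C 0 (@mv_add C) (mv_addA mvC) (mv_addC mvC) (mv_add0x mvC)).

Definition nsum a : C := \big[law/0]_(i < N) (xi i *+ a i).

Lemma nsumD a b : nsum (fun i => a i + b i)%N = nsum a + nsum b.
Proof.
by rewrite -[RHS]/(law _ _) /nsum -big_split; apply: eq_bigr => i _; exact: mv_natD.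
Qed.

Lemma nsum_inf a : inf (nsum a).
Proof.
rewrite /nsum; elim/big_ind: _ => [|x y|i _]; [exact: inf0|exact: infD|].
exact: inf_nat.
Qed.

Lemma nsum0 : nsum (fun=> 0%N) = 0.
Proof. exact: big1. Qed.

Lemma nsum_delta i : nsum (fun j => nat_of_bool (j == i)) = xi i.
Proof.
rewrite /nsum (bigD1 i) // eqxx big1 => [|j /negbTE -> //].
exact: mv_addx0.
Qed.

(* [x] is the value at [xi] of the integer linear form [l]; its negative part is
   moved to the left. *)
Definition rep x l : Prop := inf x /\ exists a b,
  (forall i, l 0%R i = (a i)%:Z - (b i)%:Z)%R /\ x + nsum b = nsum a.

(** Two splittings of [l] have the same cross sums, and sums of infinitesimals cancel; so one
    splitting in [rep] gives all. *)
Lemma rep_any x l a b : rep x l ->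
  (forall i, l 0%R i = (a i)%:Z - (b i)%:Z)%R -> x + nsum b = nsum a.
Proof.
move=> [ix [a' [b' [l' e]]]] lab.
apply: (@inf_addIr _ hC (nsum b')); try exact: nsum_inf.
  by apply: infD => //; exact: nsum_inf.
rewrite -mv_addA // (mv_addC mvC (nsum b)) mv_addA // e -!nsumD.
by congr nsum; apply/funext => i; have := l' i; rewrite lab; lia.
Qed.

Lemma rep_inf x l : rep x l -> inf x. Proof. by case. Qed.

Lemma repD x y l u : rep x l -> rep y u -> rep (x + y) (l + u)%R.
Proof.
move=> [ix [a [b [lE xE]]]] [iy [a' [b' [uE yE]]]]; split; first exact: infD.
exists (fun i => a i + a' i)%N, (fun i => b i + b' i)%N; split=> [i|].
  by rewrite mxE lE uE; lia.
by rewrite !nsumD mv_addACA // xE yE.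
Qed.

Lemma rep0 : rep 0 0%R.
Proof.
split; first exact: inf0.
exists (fun=> 0%N), (fun=> 0%N); split; last by rewrite nsum0 mv_addx0.
by move=> i; rewrite mxE.
Qed.

Lemma rep_uniq x y l : rep x l -> rep y l -> x = y.
Proof.
move=> hx hy; have [iy [a [b [lE yE]]]] := hy.
apply: (@inf_addIr _ hC (nsum b)) => //; first exact: nsum_inf.
  exact: rep_inf hx.
by rewrite yE; exact: rep_any hx lE.
Qed.

Lemma rep_delta i : rep (xi i) (delta_mx 0%R i).
Proof.
split=> //; exists (fun j => nat_of_bool (j == i)), (fun=> 0%N); split.
  by move=> j; rewrite mxE subr0 natz.
by rewrite nsum0 mv_addx0 // nsum_delta.
Qed.

Lemma rep_sub x y l u : rep x l -> rep y u -> mv_le x y ->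
  rep (mv_sub y x) (u - l)%R.
Proof.
move=> [ix [a [b [lE xE]]]] [iy [a' [b' [uE yE]]]] xy; split.
  by apply: inf_le iy => //; exact: mv_sub_le.
exists (fun i => a' i + b i)%N, (fun i => a i + b' i)%N; split=> [i|].
  by rewrite !mxE lE uE; lia.
rewrite !nsumD -xE -yE !(mv_addA mvC) (mv_subK mvC xy) -!(mv_addA mvC).
by congr (_ + _); exact: mv_addC.
Qed.

(** A chain contains only the positive infinitesimals, so a form of negative value represents no
    element: existence of a represented element is nonnegativity. *)
Definition nneg l : Prop := exists x, rep x l.

Lemma nneg_total l : nneg l \/ nneg (- l)%R.
Proof.
pose a i := if (0 <= l 0 i)%R then `|l 0%R i|%N else 0%N.
pose b i := if (0 <= l 0 i)%R then 0%N else `|l 0%R i|%N.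
have lE i : (l 0 i = (a i)%:Z - (b i)%:Z)%R by rewrite /a /b; case: ifP; lia.
case: (pchain_total hC (nsum b) (nsum a)) => h; [left|right].
  exists (mv_sub (nsum a) (nsum b)); split.
    by apply: inf_le (nsum_inf a) => //; exact: mv_sub_le.
  by exists a, b; split=> //; exact: mv_subK.
exists (mv_sub (nsum b) (nsum a)); split.
  by apply: inf_le (nsum_inf b) => //; exact: mv_sub_le.
exists b, a; split; last exact: mv_subK.
by move=> i; rewrite mxE lE opprB.
Qed.

Lemma nneg_cone : cone nneg.
Proof.
split; last exact: nneg_total.
by move=> l u [x xl] [y yu]; exists (x + y); exact: repD.
Qed.

Lemma rep_zero x l : rep x l -> nneg (- l)%R -> x = 0.
Proof.
move=> xl [y yl]; have := repD xl yl; rewrite subrr => h.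
by apply: (inf_add_eq0 hC (y := y)); exact: rep_uniq h rep0.
Qed.

Lemma rep_le x y l u : rep x l -> rep y u -> nneg (u - l)%R -> mv_le x y.
Proof.
move=> xl yu [w hw]; have := repD hw xl; rewrite subrK => h.
by rewrite -(rep_uniq h yu); exact: mv_le_addl.
Qed.

Lemma rep_le_nneg x y l u : rep x l -> rep y u -> mv_le x y -> nneg (u - l)%R.
Proof. by move=> xl yu xy; exists (mv_sub y x); exact: rep_sub. Qed.

Lemma rep_eq x y l u : rep x l -> rep y u ->
  nneg (u - l)%R -> nneg (l - u)%R -> x = y.
Proof. by move=> xl yu h1 h2; apply: (mv_le_anti mvC); apply: rep_le; eauto. Qed.

Lemma rep_nat x l k : rep x l -> rep (x *+ k) (l *+ k)%R.
Proof.
move=> xl; elim: k => [|k IH]; first by rewrite mulr0n; exact: rep0.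
by rewrite mv_natS // mulrS; exact: repD.
Qed.

End Representation.

(** * Symbolic evaluation of terms relative to an oracle *)

Section SymbolicEvaluation.
Import GRing.Theory Num.Theory.
Variables (V : Type) (N : nat) (idx : V -> 'I_N).

(** The bound leaves finitely many forms. Some bound is unavoidable, since a lexicographic preorder
    is not given by the signs at one integer point. *)
Definition box M K (l : 'rV[int]_M) : Prop := forall i, (`|l 0%R i| <= K)%N.

Lemma box_le M K K' (l : 'rV[int]_M) : (K <= K')%N -> box K l -> box K' l.
Proof. by move=> KK h i; exact: leq_trans (h i) KK. Qed.

Lemma box0 M K : @box M K 0%R. Proof. by move=> i; rewrite mxE. Qed.

Lemma boxN M K (l : 'rV[int]_M) : box K l -> box K (- l)%R.
Proof. by move=> h i; rewrite mxE abszN; exact: h. Qed.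

Lemma boxD M K K' (l u : 'rV[int]_M) : box K l -> box K' u -> box (K + K')%N (l + u)%R.
Proof.
move=> h h1 i; rewrite mxE; move: (l 0%R i) (u 0%R i) (h i) (h1 i) => x y; lia.
Qed.

Lemma boxB M K K' (l u : 'rV[int]_M) : box K l -> box K' u -> box (K + K')%N (l - u)%R.
Proof. by move=> h h'; apply: boxD => //; exact: boxN. Qed.

(* A pair [(b, l)] stands for the infinitesimal [l] if [b] is false and for its
   negation otherwise; the oracle [O] tells which forms are nonnegative. *)
Definition sadd (O : 'rV[int]_N -> bool) (p q : bool * 'rV[int]_N) :=
  match p.1, q.1 with
  | false, false => (false, p.2 + q.2)%R
  | false, true => (true, if O (q.2 - p.2)%R then q.2 - p.2 else 0)%R
  | true, false => (true, if O (p.2 - q.2)%R then p.2 - q.2 else 0)%R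
  | true, true => (true, 0%R)
  end.

Fixpoint ev (O : 'rV[int]_N -> bool) (beta : V -> bool) (t : term V) :=
  match t with
  | Var i => (beta i, delta_mx 0%R (idx i))
  | TZero => (false, 0%R)
  | TNeg s => let p := ev O beta s in (~~ p.1, p.2)
  | TAdd s1 s2 => sadd O (ev O beta s1) (ev O beta s2)
  end.

(** Counts variable occurrences, as each of them contributes at most one to a coefficient. *)
Fixpoint tsize (t : term V) : nat :=
  match t with
  | Var _ => 1%N
  | TZero => 0%N
  | TNeg s => tsize s
  | TAdd s1 s2 => (tsize s1 + tsize s2)%N
  end.

Lemma ev_box O beta t : box (tsize t) (ev O beta t).2.
Proof.
elim: t => [i||t IH|s IHs t IHt] //=.
- by move=> j; rewrite mxE; case: (_ && _).
- exact: box0.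
rewrite /sadd; case: (ev O beta s) IHs => -[] l /= Hl;
  case: (ev O beta t) IHt => -[] u /= Hu; try exact: box0.
- by case: ifP => _; [exact: boxB|exact: box0].
- by case: ifP => _; [rewrite addnC; exact: boxB|exact: box0].
- exact: boxD.
Qed.

(** The oracle is consulted only on differences of the forms of two summands, whose coefficients are
    bounded by the size of the sum. *)
Lemma eq_ev O O' beta t : (forall l, box (tsize t) l -> O l = O' l) ->
  ev O beta t = ev O' beta t.
Proof.
elim: t => [i||t IH|s IHs t IHt] //= h; first by rewrite IH.
rewrite IHs => [|l /(box_le (leq_addr _ _)) /h //].
rewrite IHt => [|l /(box_le (leq_addl _ _)) /h //].
have := ev_box O' beta s; have := ev_box O' beta t; rewrite /sadd.
case: (ev O' beta s) => -[] l; case: (ev O' beta t) => -[] u //= hu hl.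
  by rewrite h //; exact: boxB.
by rewrite h // addnC; exact: boxB.
Qed.

Variable C : mvstruct.
Hypothesis hC : pchain C.
Let mvC := pchain_mv hC.
Variables (M : nat) (xi : 'I_M -> C).
Hypothesis hxi : forall i, inf (xi i).

Definition srep (x : C) (b : bool) (l : 'rV[int]_M) : Prop :=
  rep hC xi (if b then ~` x else x) l.

(** A one-sided condition: at a form of value 0 either answer is allowed, because both branches of
    [sadd] then represent the same element. This admits oracles that break ties, such as the signs
    at a generic integer point. *)
Definition compat (O : 'rV[int]_N -> bool) (W : 'M[int]_(N, M)) K : Prop :=
  forall l, box K l -> nneg hC xi ((if O l then l else - l) *m W)%R.

Lemma srep_add O W K (x y : C) p q : compat O W K ->
  box K (q.2 - p.2)%R -> box K (p.2 - q.2)%R ->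
  srep x p.1 (p.2 *m W)%R -> srep y q.1 (q.2 *m W)%R ->
  srep (x + y) (sadd O p q).1 ((sadd O p q).2 *m W)%R.
Proof.
move=> hO; wlog: x y p q / (p.1 <= q.1)%N => [IH b1 b2 hx hy|].
  case: (leqP p.1 q.1) => [|/ltnW] h; first exact: IH.
  suff -> : sadd O p q = sadd O q p by rewrite (mv_addC mvC); exact: IH.
  by rewrite /sadd; case: p.1 (q.1) => -[] //; rewrite addrC.
case: p => -[] l; case: q => -[] u //= _ b1 b2; rewrite /srep /= => hx hy.
- rewrite mul0mx -[~` (x + y)](_ : 0 = _); first exact: rep0.
  have := inf_mul hC (rep_inf hx) (rep_inf hy).
  by rewrite /mv_mul !mv_negK // => ->.
- have -> : ~` (x + y) = mv_sub (~` y) x by rewrite /mv_sub mv_negK // mv_addC.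
  have := hO _ b1; case: ifP => _.
    rewrite mulmxBl => h; apply: rep_sub => //; exact: rep_le h.
  rewrite opprB mulmxBl mul0mx => h.
  suff /(mv_sub0P mvC) -> : mv_le (~` y) x by exact: rep0.
  exact: rep_le h.
- by rewrite mulmxDl; exact: repD.
Qed.

Lemma srep_eval O W K beta (v : V -> C) t :
  compat O W K -> (tsize t <= K)%N ->
  (forall i, srep (v i) (beta i) (row (idx i) W)) ->
  srep (eval v t) (ev O beta t).1 ((ev O beta t).2 *m W)%R.
Proof.
move=> hO hK hv; elim: t hK => [i||t IH|s IHs t IHt] /= hK.
- by rewrite -rowE; exact: hv.
- by rewrite /srep mul0mx; exact: rep0.
- have := IH hK; rewrite /srep; case: (ev O beta t).1 => //=.
  by rewrite mv_negK.
- apply: (srep_add hO); last by apply: IHt; exact: leq_trans (leq_addl _ _) hK.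
  + by apply: box_le hK _; rewrite addnC; apply: boxB; exact: ev_box.
  + by apply: box_le hK _; apply: boxB; exact: ev_box.
  + by apply: IHs; exact: leq_trans (leq_addr _ _) hK.
Qed.

Lemma srep_eq (x y : C) b b' l u : srep x b l -> srep y b' u ->
  (x = y) <-> [/\ b = b', nneg hC xi (l - u)%R & nneg hC xi (u - l)%R].
Proof.
move=> hx hy; split=> [e|[e h1 h2]]; last first.
  move: hx hy; rewrite -e /srep; case: b {e} => hx hy; last exact: rep_eq h2 h1.
  by rewrite -[x]mv_negK // -[y]mv_negK //; congr (~` _); exact: rep_eq h2 h1.
have e' : b = b'.
  have := rep_inf hx; have := rep_inf hy; rewrite -e.
  by case: b {hx}; case: b' {hy} => // h1 h2; case: (@inf_neg C hC x).
rewrite -e' -e in hy; rewrite -e'; split=> //.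
  by apply: rep_le_nneg hy hx _; exact: mv_le_refl.
by apply: rep_le_nneg hx hy _; exact: mv_le_refl.
Qed.

End SymbolicEvaluation.

(** * Realizing sign patterns of forms by integer points *)

Section Realization.
Import Order.TTheory GRing.Theory Num.Theory.
Local Open Scope ring_scope.

Lemma box_enum N K : exists s : seq 'rV[int]_N, forall l, box K l -> l \in s.
Proof.
pose f (g : {ffun 'I_N -> 'I_(K + K).+1}) : 'rV[int]_N :=
  \row_i ((g i)%:Z - K%:Z).
exists [seq f g | g <- enum {: {ffun 'I_N -> 'I_(K + K).+1}}] => l hl.
apply/mapP; exists [ffun i => inord `|(l 0 i + K%:Z)%R|%N]; first by rewrite mem_enum.
apply/rowP => i; rewrite !mxE ffunE; have := hl i.
move: (l 0 i) => x hx; rewrite inordK; lia.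
Qed.

Lemma rat_above (a : rat) (us : seq rat) : {in us, forall b, a < b} ->
  exists2 y, a < y & {in us, forall b, y < b}.
Proof.
elim: us => [|b us IH] h; first by exists (a + 1); rewrite ?ltrDl.
have [c cus|y ay yus] := IH; first by apply: h; rewrite inE cus orbT.
have ab : a < b by apply: h; rewrite mem_head.
exists (Num.min y ((a + b) / 2)).
  by rewrite lt_min ay midf_lt.
move=> c; rewrite inE => /predU1P[->|/yus yc]; rewrite gt_min ?yc //.
by rewrite midf_lt // orbT.
Qed.

Lemma rat_between (ls us : seq rat) : {in ls & us, forall a b, a < b} ->
  exists y, {in ls, forall a, a < y} /\ {in us, forall b, y < b}.
Proof.
elim: ls => [|a ls IH] h.
  elim: us {h} => [|b us [y [_ yus]]]; first by exists 0.
  exists (Num.min y (b - 1)); split=> // c; rewrite inE.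
  by case/predU1P=> [->|/yus yc]; rewrite gt_min ?yc // gtrDl ltrN10 orbT.
have [c d cl dus|y [yls yus]] := IH; first by apply: h; rewrite // inE cl orbT.
have [ay|ya] := ltP a y.
  by exists y; split=> // c; rewrite inE => /predU1P[->//|]; exact: yls.
have [b bus|z az zus] := @rat_above a us; first by apply: h; rewrite ?mem_head.
exists z; split=> // c; rewrite inE => /predU1P[->//|/yls cy].
exact: lt_le_trans cy (le_trans ya (ltW az)).
Qed.

Definition pt N (l : 'rV[int]_N) (q : 'cV[int]_N) : int := (l *m q) 0 0.

Lemma ptDl N (l u : 'rV[int]_N) q : pt (l + u) q = pt l q + pt u q.
Proof. by rewrite /pt mulmxDl mxE. Qed.
Lemma ptNl N (l : 'rV[int]_N) q : pt (- l) q = - pt l q.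
Proof. by rewrite /pt mulNmx mxE. Qed.
Lemma pt0l N (q : 'cV[int]_N) : pt 0 q = 0.
Proof. by rewrite /pt mul0mx mxE. Qed.
Lemma ptMnl N (l : 'rV[int]_N) k q : pt (l *+ k) q = pt l q *+ k.
Proof. by elim: k => [|k IH]; rewrite ?mulr0n ?pt0l // !mulrS ptDl IH. Qed.
Lemma ptDr N (l : 'rV[int]_N) q q' : pt l (q + q') = pt l q + pt l q'.
Proof. by rewrite /pt mulmxDr mxE. Qed.
Lemma ptZr N (l : 'rV[int]_N) a q : pt l (a *: q) = a * pt l q.
Proof. by rewrite /pt -scalemxAr mxE. Qed.
Lemma pt_mul N M (l : 'rV[int]_N) (W : 'M_(N, M)) q : pt (l *m W) q = pt l (W *m q).
Proof. by rewrite /pt mulmxA. Qed.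
Lemma pt_delta N i (q : 'cV[int]_N) : pt (delta_mx 0 i) q = q i 0.
Proof. by rewrite /pt -rowE mxE. Qed.

Definition form N (b : int) (u : 'rV[int]_N) : 'rV[int]_(1 + N) :=
  row_mx b%:M u.

Lemma formE N (l : 'rV[int]_(1 + N)) : l = form (l 0 0) (rsubmx l).
Proof.
rewrite /form -[LHS]hsubmxK; congr row_mx.
rewrite [LHS]mx11_scalar; congr (_%:M); rewrite mxE; congr (l _ _); exact: val_inj.
Qed.

Lemma formD N b c (u v : 'rV[int]_N) : form b u + form c v = form (b + c) (u + v).
Proof. by rewrite /form add_row_mx -raddfD. Qed.

Lemma formN N b (u : 'rV[int]_N) : - form b u = form (- b) (- u).
Proof. by rewrite /form opp_row_mx raddfN. Qed.

Lemma form0 N : form 0 (0 : 'rV[int]_N) = 0.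
Proof. by rewrite /form raddf0 row_mx0. Qed.

Lemma formMn N b (u : 'rV[int]_N) k : form b u *+ k = form (b *+ k) (u *+ k).
Proof.
by elim: k => [|k IH]; rewrite ?mulr0n ?form0 // !mulrS IH formD.
Qed.

Lemma pt_form N b (u : 'rV[int]_N) y q :
  pt (form b u) (col_mx y%:M q) = b * y + pt u q.
Proof. by rewrite /pt /form mul_row_col mxE -scalar_mxM mxE eqxx mulr1n. Qed.

Lemma box_form N K b (u : 'rV[int]_N) : box K (form b u) -> (`|b| <= K)%N /\ box K u.
Proof.
move=> h; split=> [|i].
  by have := h (lshift N 0); rewrite /form row_mxEl mxE eqxx mulr1n.
by have := h (rshift 1 i); rewrite /form row_mxEr.
Qed.

(* Fourier-Motzkin: the thresholds of the forms with positive first coefficient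
   cut the line of possible values of the first coordinate. *)
Lemma cone_realized N (P : 'rV[int]_N -> Prop) (K : nat) : cone P ->
  exists q : 'cV[int]_N, forall l, box K l -> (P l <-> 0 <= pt l q).
Proof.
elim: N P K => [|N IH] P K hP.
  exists 0 => l _; rewrite [l]thinmx0 pt0l; split=> // _; exact: cone0.
rewrite -[N.+1]/(1 + N)%N in P hP *.
pose P' u := P (form 0 u).
have hP' : cone P'.
  split=> [l u hl hu|l]; rewrite /P'.
    by rewrite -[0]addr0 -formD; exact: coneD.
  by have := cone_total hP (form 0 l); rewrite formN oppr0.
(* Eliminating the first coordinate from two forms of the box gives coefficients up to 2K^2; the
   summand [K] covers the forms whose first coefficient is 0. *)
have [q hq] := IH P' (K + (K * K + K * K))%N hP'.
(* At first coordinate -y and remaining coordinates [q], the form with first coefficient [g.1] and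
   rest [g.2] is nonnegative iff y is at most [th g]. *)
pose th (g : nat * 'rV[int]_N) : rat := (pt g.2 q)%:~R / g.1%:R.
pose inG (g : nat * 'rV[int]_N) := [/\ (0 < g.1)%N, (g.1 <= K)%N & box K g.2].
pose F (g : nat * 'rV[int]_N) := form g.1%:Z g.2.
have boxMn B u : (B <= K)%N -> box K u -> box (K * K) (u *+ B).
  move=> BK hu i; rewrite mulmxnE -mulr_natr abszM natz absz_nat.
  exact: leq_mul.
have thP g h : inG g -> inG h ->
    (th h <= th g <-> P' (g.2 *+ h.1 - h.2 *+ g.1)).
  move=> [g0 gK gb] [h0 hK hb].
  have hbox : box (K + (K * K + K * K)) (g.2 *+ h.1 - h.2 *+ g.1).
    by apply: box_le (leq_addl _ _) _; apply: boxB; exact: boxMn.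
  apply: iff_trans (iff_sym (hq _ hbox)).
  rewrite /th ler_pdivrMr ?ltr0n // mulrAC ler_pdivlMr ?ltr0n //.
  rewrite ptDl ptNl !ptMnl subr_ge0 -[pt h.2 q *+ g.1]mulr_natr -[pt g.2 q *+ h.1]mulr_natr.
  by rewrite -(ler_int rat) !intrM !natz !pmulrn.
have swap a b : a%:Z *+ b = b%:Z *+ a.
  by rewrite -[LHS]mulr_natr -[RHS]mulr_natr !natz mulrC.
have up g h : inG g -> inG h -> th h <= th g -> P (F h) -> P (F g).
  move=> hg hh /(thP g h hg hh) Pd Ph; case: hg hh => g0 _ _ [h0 _ _].
  apply: (coneMn_inv hP h0).
  suff -> : F g *+ h.1 = form 0 (g.2 *+ h.1 - h.2 *+ g.1) + F h *+ g.1.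
    by apply: coneD => //; exact: coneMn.
  by rewrite /F !formMn formD subrK add0r swap.
have down g h : inG g -> inG h -> th h <= th g -> P (- F g) -> P (- F h).
  move=> hg hh /(thP g h hg hh) Pd Ph; case: hg hh => g0 _ _ [h0 _ _].
  apply: (coneMn_inv hP g0).
  suff -> : (- F h) *+ g.1 = form 0 (g.2 *+ h.1 - h.2 *+ g.1) + (- F g) *+ h.1.
    by apply: coneD => //; exact: coneMn.
  rewrite /F !formN !formMn formD !mulNrn addrAC subrr !add0r.
  by rewrite swap.
have cross g h : inG g -> inG h -> P (F g) -> P (- F h) -> th h <= th g.
  move=> hg hh Pg Ph; apply/(thP g h hg hh).
  suff e : form 0 (g.2 *+ h.1 - h.2 *+ g.1) = F g *+ h.1 + (- F h) *+ g.1.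
    by rewrite /P' e; apply: coneD => //; exact: coneMn.
  by rewrite /F formN !formMn formD !mulNrn swap subrr.
have [w hw] : exists w : rat, forall g, inG g ->
    (P (F g) <-> w <= th g) /\ (P (- F g) <-> th g <= w).
  (* A form that is null for the preorder forces the value of w. Without one, all comparisons of
     thresholds are strict and density of the rationals provides w. *)
  have [[g0 [G0 Pg0 Ng0]]|none] := pselect (exists g, [/\ inG g, P (F g) & P (- F g)]).
    exists (th g0) => g Gg; split; split.
    - by move=> Pg; exact: cross.
    - by move=> h; exact: up h _.
    - by move=> Ng; exact: cross.
    - by move=> h; exact: down h _.
  have [s hs] := box_enum N K.
  pose gs := [seq (B, u) | B <- iota 0 K.+1, u <- s].
  have Ggs g : inG g -> g \in gs.
    case: g => B u [/= B0 BK hu]; apply: allpairs_f; last exact: hs.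
    by rewrite mem_iota.
  pose ls := [seq th g | g <- gs & `[< inG g /\ ~ P (F g) >]].
  pose us := [seq th g | g <- gs & `[< inG g /\ P (F g) >]].
  have [a b|w [hl hu]] := @rat_between ls us.
    move=> /mapP [g + ->] /mapP [h + ->]; rewrite !mem_filter.
    move=> /andP[/asboolP [Gg nPg] _] /andP[/asboolP [Gh Ph] _].
    have Ng : P (- F g) by case: (cone_total hP (F g)).
    rewrite lt_neqAle (cross _ _ Gh Gg Ph Ng) andbT; apply/eqP => e.
    by apply: nPg; apply: up Ph => //; rewrite e.
  exists w => g Gg; have gg := Ggs g Gg.
  have [Pg|nPg] := pselect (P (F g)).
    have wg : w < th g.
      by apply: hu; apply/mapP; exists g; rewrite // mem_filter gg andbT; apply/asboolP.
    split; split; [by move=> _; exact: ltW|by []| |by rewrite leNgt wg].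
    by move=> Ng; case: none; exists g.
  have wg : th g < w.
    by apply: hl; apply/mapP; exists g; rewrite // mem_filter gg andbT; apply/asboolP.
  split; split; [by []|by rewrite leNgt wg|by move=> _; exact: ltW|].
  by case: (cone_total hP (F g)).
(* The point (-w, q), made integral by the denominator of w. *)
pose d := denq w; pose p := numq w.
have d0 : 0 < d := denq_gt0 w.
have sgn g : inG g -> (0 <= pt (F g) (col_mx (- p)%:M (d *: q))) = (w <= th g) /\
    (pt (F g) (col_mx (- p)%:M (d *: q)) <= 0) = (th g <= w).
  move=> [g0 _ _]; rewrite pt_form ptZr mulrN.
  have -> : (w <= th g) = (g.1%:Z * p <= d * pt g.2 q).
    rewrite -{1}[w]divq_num_den -/p -/d /th ler_pdivrMr ?ltr0z // mulrAC.
    rewrite ler_pdivlMr ?ltr0n // -(ler_int rat) !intrM pmulrn.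
    by rewrite [p%:~R * _]mulrC [d%:~R * _]mulrC.
  have -> : (th g <= w) = (d * pt g.2 q <= g.1%:Z * p).
    rewrite -{1}[w]divq_num_den -/p -/d /th ler_pdivlMr ?ltr0z // mulrAC.
    rewrite ler_pdivrMr ?ltr0n // -(ler_int rat) !intrM pmulrn.
    by rewrite [p%:~R * _]mulrC [d%:~R * _]mulrC.
  by rewrite addrC subr_ge0 subr_le0.
exists (col_mx (- p)%:M (d *: q)) => l; rewrite [l]formE => /box_form [bK uK].
move: (l 0 0) (rsubmx l) bK uK => b u bK uK.
have [b0|b0|->] := ltrgtP b 0.
- pose g := (`|b|%N, - u).
  have Gg : inG g by split=> //=; [lia|exact: boxN].
  have e : form b u = - F g by rewrite /F formN opprK; congr form; rewrite /=; lia.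
  have [_ h1] := hw g Gg; have [_ h2] := sgn g Gg.
  by rewrite e ptNl oppr_ge0 h2.
- pose g := (`|b|%N, u).
  have Gg : inG g by split=> //=; lia.
  have e : form b u = F g by rewrite /F; congr form; rewrite /=; lia.
  have [h1 _] := hw g Gg; have [h2 _] := sgn g Gg.
  by rewrite e h2.
rewrite pt_form mul0r add0r ptZr pmulr_rge0 //; apply: (hq u).
by apply: box_le uK; exact: leq_addr.
Qed.

Definition break_ties N (P : 'rV[int]_N -> Prop) i (l : 'rV[int]_N) : Prop :=
  P l /\ (P (- l) -> 0 <= l 0 i).

Lemma cone_break_ties N (P : 'rV[int]_N -> Prop) i : cone P -> cone (break_ties P i).
Proof.
move=> hP; split=> [l u [Pl hl] [Pu hu]|l].
  split=> [|Pn]; first exact: coneD.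
  have el : - l = - (l + u) + u by rewrite opprD subrK.
  have eu : - u = - (l + u) + l by rewrite opprD addrAC addNr add0r.
  rewrite mxE addr_ge0 //.
    by apply: hl; rewrite el; exact: coneD.
  by apply: hu; rewrite eu; exact: coneD.
rewrite /break_ties opprK mxE oppr_ge0.
have [Pl|Pl] := pselect (P l); have [Pn|Pn] := pselect (P (- l)).
- by case: (lerP 0 (l 0 i)) => [|/ltW] h; [left|right].
- by left.
- by right.
- by case: (cone_total hP l).
Qed.

(* Breaking the ties of the preorder by the signs of the coefficients gives a
   total order, which is realized by a generic point. *)
Lemma cone_generic N (P : 'rV[int]_N -> Prop) (K : nat) : cone P ->
  exists q : 'cV[int]_N,
    (forall l, box K l -> l != 0 -> pt l q != 0 /\ (0 < pt l q -> P l)) /\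
    (forall i, P (delta_mx 0 i) -> 0 <= q i 0).
Proof.
move=> hP; pose Q s := foldr (fun i P' => break_ties P' i) P s.
have hQ s : cone (Q s) by elim: s => //= i s; exact: cone_break_ties.
have QP s l : Q s l -> P l by elim: s => //= i s IH [/IH].
have Q0 s l : Q s l -> Q s (- l) -> forall i, i \in s -> l 0 i = 0.
  elim: s => //= i s IH [Ql hl] [Qn hn] j; rewrite inE => /predU1P[->|]; last exact: IH.
  apply: le_anti; rewrite hl // andbT -oppr_ge0.
  by have := hn; rewrite opprK mxE; apply.
have Qpos s l : P l -> (forall i, 0 <= l 0 i) -> Q s l.
  by move=> Pl hl; elim: s => //= i s IH; split.
(* The bound [K.+1] is positive, so the coordinate forms are realized as well. *)
have [q hq] := cone_realized K.+1 (hQ (enum 'I_N)).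
exists q; split=> [l bl l0|i Pi].
  have bl' : box K.+1 l := box_le (leqnSn K) bl.
  split=> [|/ltW /(hq l bl') /QP //]; apply: contra_neq l0 => e.
  apply/rowP => i; rewrite mxE; apply: (Q0 (enum 'I_N)); last exact: mem_enum.
    by apply/(hq l bl'); rewrite e.
  by apply/(hq (- l) (boxN bl')); rewrite ptNl e oppr0.
rewrite -pt_delta; apply/hq.
  by move=> j; rewrite mxE; case: (_ && _).
by apply: Qpos => // j; rewrite mxE; case: (_ && _).
Qed.

End Realization.

(** * Solutions in chains and integral solutions *)

Definition two : mvstruct := @MvStruct bool orb negb false.

Section Signs.
Variable C : mvstruct.
Hypothesis hC : pchain C.
Let mvC := pchain_mv hC.

Definition mv_sign (b : bool) (x : C) : C := if b then ~` x else x.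

Lemma mv_signK b x : mv_sign b (mv_sign b x) = x.
Proof. by case: b => //=; rewrite mv_negK. Qed.

Definition bit (x : C) : bool := ~~ `[< inf x >].

Lemma inf_bit (x : C) : inf (mv_sign (bit x) x).
Proof. by rewrite /bit; case: asboolP => //= ix; case: (inf_or hC x). Qed.

Lemma bitE b (x : C) : inf (mv_sign b x) -> bit x = b.
Proof.
rewrite /bit; case: b => /= ix; last by apply/negbTE; rewrite negbK; apply/asboolP.
by apply/asboolP => ix'; exact: (inf_neg hC ix').
Qed.

Lemma bit_hom : @mv_hom C two bit.
Proof.
have N (x : C) : bit (~` x) = ~~ bit x.
  apply: bitE; have := inf_bit x; case: (bit x) => //=; by rewrite mv_negK.
split=> //=; last by apply: bitE; exact: inf0.
move=> x y; have := inf_bit x; have := inf_bit y.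
case: (bit x) => /= hy hx; [|case: (bit y) hy => /= hy]; apply: bitE => /=.
- apply: inf_le hx => //; apply: mv_le_neg => //; exact: mv_le_addr.
- apply: inf_le hy => //; apply: mv_le_neg => //; exact: mv_le_addl.
- exact: infD.
Qed.

End Signs.

Section TwoElements.
Variable A : mvstruct.
Hypothesis hA : mv_algebra A.

Definition of_two (b : two) : A := if b then ~` 0 else 0.

Lemma of_two_hom : mv_hom of_two.
Proof.
split=> //.
  by move=> [] [] /=; rewrite /of_two /= ?mv_addx1 ?mv_addx0 ?mv_add1x.
by move=> [] /=; rewrite /of_two /= ?mv_negK.
Qed.

End TwoElements.

(** The two-element algebra is a retract of [A]: [of_two] embeds it, and [bit] on a chain quotient
    maps back. The retraction carries solutions back, and two solutions are compared in [A]. *)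
Lemma two_satisfies (phi : efd) (A : mvstruct) :
  generated_variety perfect A -> 0 <> ~` 0 :> A -> satisfies A phi -> satisfies two phi.
Proof.
move=> VA A01 sA; have mvA := generated_variety_mv VA.
have [C [p [cC hp sp _]]] := separating_chain_eq mvA A01.
have hC := pchain_quotient VA cC hp sp.
have hi := of_two_hom mvA.
have hb : @mv_hom A two (fun a => bit (p a)).
  have hb := bit_hom hC; split=> [x y|x|].
  - by rewrite (mv_homD hp) (mv_homD hb).
  - by rewrite (mv_homN hp) (mv_homN hb).
  - by rewrite (mv_hom0 hp) (mv_hom0 hb).
have bK b : bit (p (of_two A b)) = b.
  by case: b; rewrite -?[true]/(negb false) /of_two ?(mv_homN hb) (mv_hom0 hb).
move=> x; have [z [sz _]] := sA (map_tuple (of_two A) x).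
have {}bK l (t : l.-tuple two) : map_tuple (fun a => bit (p a)) (map_tuple (of_two A) t) = t.
  by apply: eq_from_tnth => i; rewrite !tnth_map bK.
exists (map_tuple (fun a => bit (p a)) z); split.
  by have := sol_map hb sz; rewrite bK.
move=> z' sz'; rewrite -[RHS]bK; congr (map_tuple _ _).
by apply: satisfies_unique sz _ => //; exact: sol_map.
Qed.

(** * The test of a sign pattern, and uniqueness in chains *)

Section Core.
Import Order.TTheory GRing.Theory Num.Theory.
Variable phi : efd.
Local Notation n := (efd_n phi).
Local Notation m := (efd_m phi).
Local Notation var := ('I_n + 'I_m)%type.

Definition idx (i : var) : 'I_(n + m) := unsplit i.

(** Bounds all forms compared in the sentence. The successor puts the coordinate forms in the box,
    so that entries stay nonnegative when a point is replaced. *)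
Definition depth : nat :=
  (\sum_(i < efd_k phi) (tsize (efd_lhs i) + tsize (efd_rhs i))).+1.

Lemma depth_ge (i : 'I_(efd_k phi)) :
  (tsize (efd_lhs i) + tsize (efd_rhs i) <= depth)%N.
Proof. by apply: leqW; rewrite (bigD1 i) //= leq_addr. Qed.

(** The system as the oracle sees it. No algebra occurs, so the same condition applies to chains and
    to integer points. *)
Definition test (O : 'rV[int]_(n + m) -> bool) (beta : var -> bool) : Prop :=
  forall i : 'I_(efd_k phi),
    let p := ev idx O beta (efd_lhs i) in let q := ev idx O beta (efd_rhs i) in
    [/\ p.1 = q.1, O (p.2 - q.2)%R & O (q.2 - p.2)%R].

Lemma eq_test O O' beta : (forall l, box depth l -> O l = O' l) ->
  test O beta -> test O' beta.
Proof.
move=> eO h i; have hi := depth_ge i.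
have el : ev idx O' beta (efd_lhs i) = ev idx O beta (efd_lhs i).
  apply: eq_ev => l bl; rewrite eO //; apply: box_le bl.
  exact: leq_trans (leq_addr _ _) hi.
have er : ev idx O' beta (efd_rhs i) = ev idx O beta (efd_rhs i).
  apply: eq_ev => l bl; rewrite eO //; apply: box_le bl.
  exact: leq_trans (leq_addl _ _) hi.
have [h1 h2 h3] := h i; rewrite /= el er; split=> //; rewrite -eO //.
  by apply: box_le hi _; apply: boxB; exact: ev_box.
by apply: box_le hi _; rewrite [(tsize _ + _)%N]addnC; apply: boxB; exact: ev_box.
Qed.

Section TestInChain.
Variables (C : mvstruct) (hC : pchain C) (M : nat) (xi : 'I_M -> C).
Hypothesis hxi : forall i, inf (xi i).
Variables (W : 'M[int]_(n + m, M)) (beta : var -> bool) (v : var -> C).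
Hypothesis hv : forall i, srep hC xi (v i) (beta i) (row (idx i) W).

Lemma sol_of_test O : compat hC xi O W depth -> test O beta -> sol v.
Proof.
move=> hO h i; have [h1 h2 h3] := h i; have hi := depth_ge i.
have hl := srep_eval hxi hO (leq_trans (leq_addr _ _) hi) hv.
have hr := srep_eval hxi hO (leq_trans (leq_addl _ _) hi) hv.
apply/(srep_eq hxi hl hr); split=> //; rewrite -mulmxBl.
  have := hO ((ev idx O beta (efd_lhs i)).2 - (ev idx O beta (efd_rhs i)).2)%R.
  rewrite h2; apply; apply: box_le hi _; apply: boxB; exact: ev_box.
have := hO ((ev idx O beta (efd_rhs i)).2 - (ev idx O beta (efd_lhs i)).2)%R.
rewrite h3; apply; apply: box_le hi _; rewrite [(tsize _ + _)%N]addnC; apply: boxB; exact: ev_box.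
Qed.

(** Here the oracle has to be exact: a one-sided one may answer no at a form of value 0 and so miss
    an equality that holds in the chain. *)
Lemma test_of_sol (O : 'rV[int]_(n + m) -> bool) :
  (forall l, box depth l -> O l <-> nneg hC xi (l *m W)%R) ->
  sol v -> test O beta.
Proof.
move=> hO h i; have hi := depth_ge i.
have cO : compat hC xi O W depth.
  move=> l bl; have := hO l bl; case: (O l) => -[h1 h2]; first exact: h1.
  rewrite mulNmx; case: (nneg_total hC hxi (l *m W)%R) => // /h2 //.
have hl := srep_eval hxi cO (leq_trans (leq_addr _ _) hi) hv.
have hr := srep_eval hxi cO (leq_trans (leq_addl _ _) hi) hv.
have [h1 h2 h3] := (srep_eq hxi hl hr).1 (h i).
rewrite -mulmxBl in h2; rewrite -mulmxBl in h3.
split=> //; apply/hO => //.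
  by apply: box_le hi _; apply: boxB; exact: ev_box.
by apply: box_le hi _; rewrite [(tsize _ + _)%N]addnC; apply: boxB; exact: ev_box.
Qed.

End TestInChain.

(* The [i]-th variable is the [p_i]-th multiple of a fixed infinitesimal, negated if
   [beta i] holds. *)
Definition int_sol (beta : var -> bool) (p : 'cV[int]_(n + m)) : Prop :=
  test (fun l => 0 <= pt l p)%R beta /\ forall i, (0 <= p i 0%R)%R.

Lemma int_solZ beta c p : (0 < c)%R -> int_sol beta (c *: p)%R <-> int_sol beta p.
Proof.
move=> c0; have e l : (0 <= pt l (c *: p))%R = (0 <= pt l p)%R.
  by rewrite ptZr pmulr_rge0.
rewrite /int_sol; split=> -[h1 h2]; split=> [|i].
- by apply: eq_test h1 => l _; rewrite e.
- by have := h2 i; rewrite mxE pmulr_rge0.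
- by apply: eq_test h1 => l _; rewrite e.
- by rewrite mxE pmulr_rge0.
Qed.

Lemma box_mul M K (W : 'M[int]_(n + m, M)) :
  exists K', forall l, box K l -> box K' (l *m W)%R.
Proof.
exists (\sum_j \sum_i K * `|W i j|)%N => l bl j; rewrite mxE.
apply: leq_trans (_ : \sum_i K * `|W i j| <= _)%N; last by rewrite [leqRHS](bigD1 j) //= leq_addr.
elim/big_ind2: _ => // [a x b y ha hb|i _].
  by move: ha hb; lia.
by rewrite abszM leq_mul2r bl orbT.
Qed.

(** The point [q] imitates [xi] on the forms of the test pulled back along [W], and on a further box
    [K], by which a caller learns signs at [q] itself. *)
Lemma int_sol_of_sol (C : mvstruct) (hC : pchain C) M (xi : 'I_M -> C)
    (W : 'M[int]_(n + m, M)) beta (v : var -> C) K :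
  (forall i, inf (xi i)) ->
  (forall i, srep hC xi (v i) (beta i) (row (idx i) W)) -> sol v ->
  exists q : 'cV[int]_M, (forall l, box K l -> nneg hC xi l <-> (0 <= pt l q)%R) /\
    int_sol beta (W *m q)%R.
Proof.
move=> hxi hv sv; have [K1 hK1] := box_mul depth W.
have [q hq] := cone_realized (maxn K K1) (nneg_cone hC hxi).
have tq : test (fun l => 0 <= pt l (W *m q))%R beta.
  apply: (test_of_sol hxi hv) => // l bl; rewrite -pt_mul; apply: iff_sym.
  by apply: hq; apply: box_le (leq_maxr _ _) (hK1 l bl).
exists q; split=> [l bl|]; first by apply: hq; apply: box_le (leq_maxl _ _) bl.
split=> // i; rewrite -pt_delta -pt_mul; apply/hq.
  apply: box_le (leq_maxr _ _) (hK1 _ _) => j; rewrite mxE; by case: (_ && _).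
rewrite -rowE; case: (splitP i) => j ij.
  have -> : i = idx (inl j) by apply: val_inj.
  by case: (beta (inl j)) (hv (inl j)) => r; eexists; exact: r.
have -> : i = idx (inr j) by apply: val_inj.
by eexists; exact: hv.
Qed.

Definition int_unique beta : Prop := forall p p' : 'cV[int]_(n + m),
  int_sol beta p -> int_sol beta p' -> usubmx p = usubmx p' -> p = p'.

(** Existence over the rationals: by homogeneity ([int_solZ]) the factor [d] clears the denominators
    of a solution over [q]. *)
Definition int_exists beta : Prop := forall q : 'cV[int]_n, (forall i, 0 <= q i 0)%R ->
  exists d p, [/\ (0 < d)%R, int_sol beta p & usubmx p = (d *: q)%R].

(** Both solutions are put on one list of infinitesimals and realized by a single integer point. Its
    halves are integer solutions with the same x-part, hence equal. Since the point also realizes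
    the differences of matching coordinates, equality returns to the chain. *)
Lemma chain_unique beta (C : mvstruct) (hC : pchain C) (v w : var -> C) :
  int_unique beta ->
  (forall i, inf (mv_sign (beta i) (v i))) -> (forall i, inf (mv_sign (beta i) (w i))) ->
  sol v -> sol w -> (forall i, v (inl i) = w (inl i)) -> forall i, v i = w i.
Proof.
move=> hu iv iw sv sw xvw; have mvC := pchain_mv hC.
pose f (u : var -> C) (i : 'I_(n + m)) := mv_sign (beta (split i)) (u (split i)).
pose xi (i : 'I_((n + m) + (n + m))) :=
  match split i with inl j => f v j | inr j => f w j end.
have hxi i : inf (xi i) by rewrite /xi /f; case: split.
have xil i : xi (lshift _ (idx i)) = mv_sign (beta i) (v i).
  by rewrite /xi /f -[lshift _ _]/(unsplit (inl _)) unsplitK /idx unsplitK.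
have xir i : xi (rshift _ (idx i)) = mv_sign (beta i) (w i).
  by rewrite /xi /f -[rshift _ _]/(unsplit (inr _)) unsplitK /idx unsplitK.
pose W1 : 'M[int]_(n + m, (n + m) + (n + m)) := row_mx 1%:M%R 0%R.
pose W2 : 'M[int]_(n + m, (n + m) + (n + m)) := row_mx 0%R 1%:M%R.
have r1 i : row i W1 = delta_mx 0%R (lshift _ i).
  by rewrite /W1 row_row_mx row1 row0 delta_mx_lshift.
have r2 i : row i W2 = delta_mx 0%R (rshift _ i).
  by rewrite /W2 row_row_mx row1 row0 delta_mx_rshift.
have hv i : srep hC xi (v i) (beta i) (row (idx i) W1).
  by rewrite r1 /srep -/(mv_sign _ _) -xil; exact: rep_delta.
have hw i : srep hC xi (w i) (beta i) (row (idx i) W2).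
  by rewrite r2 /srep -/(mv_sign _ _) -xir; exact: rep_delta.
have [K1 hK1] := box_mul depth W1; have [K2 hK2] := box_mul depth W2.
have [q hq] := cone_realized (2 + (K1 + K2)) (nneg_cone hC hxi).
have sol1 (u : var -> C) (W : 'M[int]_(n + m, (n + m) + (n + m))) g :
    (forall l, box depth l -> box (K1 + K2) (l *m W)%R) ->
    (forall i, row i W = delta_mx 0%R (g i)) ->
    (forall i, srep hC xi (u i) (beta i) (row (idx i) W)) -> sol u ->
    int_sol beta (W *m q)%R.
  move=> hK hW hu' su; split.
    apply: (test_of_sol hxi hu') => // l bl; rewrite -pt_mul; apply: iff_sym.
    by apply: hq; apply: box_le (leq_addl _ _) (hK l bl).
  move=> i; rewrite -pt_delta -pt_mul -rowE hW; apply/hq.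
    by move=> j; rewrite mxE; case: (_ && _).
  by exists (xi (g i)); exact: rep_delta.
have s1 := sol1 v W1 _ (fun l bl => box_le (leq_addr _ _) (hK1 l bl)) r1 hv sv.
have s2 := sol1 w W2 _ (fun l bl => box_le (leq_addl _ _) (hK2 l bl)) r2 hw sw.
have bd i : box (2 + (K1 + K2)) (delta_mx 0 (lshift _ i) - delta_mx 0 (rshift _ i) : 'rV_((n + m) + (n + m)))%R.
  by apply: box_le (leq_addr _ _) _; apply: (@boxB _ 1 1) => j; rewrite mxE; case: (_ && _).
have qE i : xi (lshift _ i) = xi (rshift _ i) <-> q (lshift _ i) 0%R = q (rshift _ i) 0%R.
  have rl := rep_delta hC hxi (lshift (n + m) i).
  have rr := rep_delta hC hxi (rshift (n + m) i).
  have hl := hq _ (bd i); have hr := hq _ (boxN (bd i)).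
  rewrite ptNl oppr_ge0 opprB in hr.
  rewrite ptDl ptNl !pt_delta subr_ge0 in hl; rewrite ptDl ptNl !pt_delta subr_le0 in hr.
  split=> [e|e].
    apply: le_anti; apply/andP; split; [apply/hr|apply/hl].
      by apply: rep_le_nneg rl rr _ => //; rewrite e; exact: mv_le_refl.
    by apply: rep_le_nneg rr rl _ => //; rewrite e; exact: mv_le_refl.
  by apply: (rep_eq hxi rl rr); [apply/hr|apply/hl]; rewrite e.
have W1q : (W1 *m q)%R = usubmx q by rewrite -{1}[q]vsubmxK mul_row_col mul1mx mul0mx addr0.
have W2q : (W2 *m q)%R = dsubmx q by rewrite -{1}[q]vsubmxK mul_row_col mul1mx mul0mx add0r.
rewrite W1q in s1; rewrite W2q in s2.
have uq : usubmx q = dsubmx q.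
  apply: hu => //; apply/colP => i; rewrite !mxE.
  have := qE (idx (inl i)); rewrite xil xir xvw => -[h _].
  exact: h.
move=> i; rewrite -[LHS](mv_signK hC (beta i)) -[RHS](mv_signK hC (beta i)).
congr mv_sign; rewrite -xil -xir; apply/qE.
by have /colP /(_ (idx i)) := uq; rewrite !mxE.
Qed.

End Core.

(** * Integer solutions obtained from a non-Boolean model *)

Section IntegralSolutions.
Import Order.TTheory GRing.Theory Num.Theory.
Variable phi : efd.
Local Notation n := (efd_n phi).
Local Notation m := (efd_m phi).
Local Notation var := ('I_n + 'I_m)%type.
Implicit Types beta : var -> bool.

Lemma inf_nat_inj (C : mvstruct) (hC : pchain C) (g : C) k l :
  inf g -> g <> 0 -> g *+ k = g *+ l -> k = l.
Proof.
move=> ig g0; have mvC := pchain_mv hC.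
wlog kl : k l / (k <= l)%N => [IH e|].
  by case/orP: (leq_total k l) => h; [|symmetry]; exact: IH.
rewrite -(subnK kl); case: (l - k)%N => [//|d]; rewrite mv_natD // => e.
case: g0; have := @inf_addIr _ hC (g *+ k) 0 (g *+ d.+1).
rewrite mv_add0x // => /(_ (inf_nat hC k ig) (inf0 hC) (inf_nat hC _ ig) e) /esym.
by rewrite mv_natS //; exact: inf_add_eq0.
Qed.

Definition multiples (A : mvstruct) (g : A) beta (p : 'cV[int]_(n + m)) (i : var) : A :=
  mv_sign (beta i) (g *+ `|p (idx i) 0%R|%N).

Lemma sol_multiples_chain (C : mvstruct) (hC : pchain C) (g : C) beta p :
  inf g -> int_sol beta p -> sol (multiples g beta p).
Proof.
move=> ig [tp p0]; have mvC := pchain_mv hC.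
pose xi (_ : 'I_1) := g.
have hxi i : inf (xi i) by [].
have hg k (l : 'rV[int]_1) : l 0%R 0%R = k%:Z%R -> rep hC xi (g *+ k) l.
  move=> lE; suff -> : (l = delta_mx 0 0 *+ k)%R by apply: rep_nat => //; exact: (rep_delta hC hxi).
  apply/rowP => i; rewrite ord1 mulmxnE lE mxE !eqxx /=.
  exact: (esym (natz k)).
have hv i : srep hC xi (multiples g beta p i) (beta i) (row (idx i) p).
  rewrite /srep /multiples -/(mv_sign _ _) mv_signK //; apply: hg.
  by rewrite mxE; have := p0 (idx i); lia.
apply: (sol_of_test hxi hv _ tp) => l bl.
exists (g *+ `|pt l p|%N); apply: hg; case: ifP => h.
  by rewrite gez0_abs.
rewrite mulNmx mxE lez0_abs //; move: h; by case: ltP => // /ltW.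
Qed.

Section Model.
Variable A : mvstruct.
Hypotheses (VA : generated_variety perfect A) (sA : satisfies A phi).
Let mvA := generated_variety_mv VA.
Variable x : A.
Hypothesis xx : x + x <> x.
(** Infinitesimal in every chain quotient, because x or its negation is; nonzero in one where x + x
    and x differ. *)
Let g : A := mv_meet x (~` x).

Let g_inf (C : mvstruct) (p : A -> C) : mv_chain C -> mv_hom p -> onto p -> inf (p g).
Proof.
move=> cC hp sp; have hC := pchain_quotient VA cC hp sp; have mvC := pchain_mv hC.
rewrite (hom_meet hp) (mv_homN hp); case: (inf_or hC (p x)) => h.
  by apply: inf_le h => //; exact: mv_meet_lel.
by apply: inf_le h => //; exact: mv_meet_ler.
Qed.

Let g_neq0 : exists (C : mvstruct) (p : A -> C),
  [/\ pchain C, mv_hom p, onto p, inf (p g) & p g <> 0].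
Proof.
have [C [p [cC hp sp]]] := separating_chain_eq mvA xx.
have hC := pchain_quotient VA cC hp sp; have mvC := pchain_mv hC.
rewrite (mv_homD hp) => pxx; exists C, p; split=> //; first exact: g_inf.
rewrite (hom_meet hp) (mv_homN hp) => e; apply: pxx.
case: (pchain_total hC (p x) (~` (p x))) => h.
  by rewrite mv_meet_idl // in e; rewrite e mv_addx0.
rewrite mv_meet_idr // in e; rewrite -[p x](mv_negK mvC) e.
exact: mv_addx1.
Qed.

(** Equations are checked in the chain quotients, where the image of [g] is infinitesimal, possibly
    0. The solution lives in the model itself, where uniqueness is available. *)
Let sol_multiples beta p : int_sol beta p -> sol (multiples g beta p).
Proof.
move=> sp i; apply: contrapT => /(separating_chain_eq mvA) [C [f [cC hf sf]]].
have hC := pchain_quotient VA cC hf sf; apply.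
have fE j : f (multiples g beta p j) = multiples (f g) beta p j.
  rewrite /multiples /mv_sign -(hom_nat hf).
  by case: (beta j) => //; rewrite (mv_homN hf).
rewrite !(hom_eval _ hf fE); apply: sol_multiples_chain sp _ => //.
exact: g_inf.
Qed.

Let valuation_fun B (v : var -> B) :
  valuation (mktuple (fun i => v (inl i))) (mktuple (fun j => v (inr j))) = v.
Proof. by apply/funext => -[] i /=; rewrite tnth_mktuple. Qed.

(** Two integer solutions give tuples of multiples of [g] that solve the system in [A], hence
    coincide; in a chain where [g] survives, distinct multiples are distinct. *)
Lemma int_unique_of_model beta : int_unique beta.
Proof.
move=> p p' sp sp' pp'.
have [C [f [hC hf sf ig g0]]] := g_neq0.
have e i : multiples g beta p (inl i) = multiples g beta p' (inl i).
  congr (mv_sign _ (_ *+ `|_|%N)); have /colP /(_ i) := pp'; rewrite !mxE.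
  by [].
have s1 := sol_multiples sp; have s2 := sol_multiples sp'.
rewrite -(valuation_fun (multiples g beta p)) in s1.
rewrite -(valuation_fun (multiples g beta p')) in s2.
have ex : mktuple (fun i => multiples g beta p (inl i)) =
    mktuple (fun i => multiples g beta p' (inl i)).
  by apply: eq_from_tnth => i; rewrite !tnth_mktuple.
rewrite -ex in s2; have ez := satisfies_unique sA s1 s2.
apply/colP => k; case: (split_ordP k) => j -> {k}.
  by have /colP /(_ j) := pp'; rewrite !mxE.
have := congr1 (fun t => f (tnth t j)) ez; rewrite !tnth_mktuple /multiples.
have [_ p0] := sp; have [_ p0'] := sp'.
have := p0 (rshift n j); have := p0' (rshift n j).
rewrite /idx /= => h1 h2 h3.
suff /(inf_nat_inj hC ig g0) : f g *+ `|p (rshift n j) 0%R|%N = f g *+ `|p' (rshift n j) 0%R|%N.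
  by lia.
rewrite -!(hom_nat hf); case: (beta (inr j)) h3 => //=; rewrite !(mv_homN hf).
by move=> /(congr1 (@mv_neg C)); rewrite !mv_negK //; exact: pchain_mv.
Qed.

(** The model is solved at the multiples of [g] given by [q], and the solution is sent to a chain
    where [g] survives; the two-element algebra fixes its signs as [del]. An integer point realizing
    [g] and the z-values has a positive first entry, which serves as [d]. *)
Lemma int_exists_of_model (eps : n.-tuple two) (del : m.-tuple two) :
  satisfies two phi -> sol (valuation eps del) -> int_exists (valuation eps del).
Proof.
move=> s2 sed q q0; have [C [f [hC hf sf ig g0]]] := g_neq0.
pose X : n.-tuple A := mktuple (fun i => mv_sign (tnth eps i) (g *+ `|q i 0%R|%N)).
have [z [sz _]] := sA X; have {}sz := sol_map hf sz.
have mvC := pchain_mv hC.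
have XE i : mv_sign (tnth eps i) (tnth (map_tuple f X) i) = f g *+ `|q i 0%R|%N.
  rewrite tnth_map tnth_mktuple -(hom_nat hf).
  by case: (tnth eps i) => //=; rewrite (mv_homN hf) mv_negK.
have bE : map_tuple (@bit C) (map_tuple f X) = eps.
  apply: eq_from_tnth => i; rewrite tnth_map; apply: (bitE hC).
  by rewrite XE; exact: inf_nat.
have := sol_map (bit_hom hC) sz; rewrite bE => sb.
have dE := satisfies_unique s2 sb sed.
pose xi (i : 'I_(1 + m)) := match split i with
  | inl _ => f g | inr j => mv_sign (tnth del j) (tnth (map_tuple f z) j) end.
have hxi i : inf (xi i).
  rewrite /xi; case: split => // j.
  by rewrite -dE tnth_map; exact: inf_bit.
pose W : 'M[int]_(n + m, 1 + m) := block_mx q 0%R 0%R 1%:M%R.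
have hW i : srep hC xi (valuation (map_tuple f X) (map_tuple f z) i)
    (valuation eps del i) (row (idx i) W).
  rewrite /srep -/(mv_sign _ _); case: i => i; rewrite /idx /unsplit /W.
    rewrite rowKu row_row_mx row0 /= XE.
    suff -> : (row_mx (row i q) 0 = delta_mx 0 (lshift m (0 : 'I_1)) *+ `|q i 0%R|%N)%R.
      apply: rep_nat => //; suff {1}-> : f g = xi (lshift m 0%R) by exact: rep_delta.
      by rewrite /xi -[lshift m _]/(unsplit (inl _)) unsplitK.
    have -> : delta_mx 0%R (lshift m (0%R : 'I_1)) = form 1%R (0%R : 'rV[int]_m).
      rewrite delta_mx_lshift; congr row_mx; apply/matrixP => j k.
      by rewrite !ord1 !mxE.
    rewrite formMn mul0rn; congr row_mx; apply/matrixP => j k.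
    rewrite !ord1 !mxE /= mulr1n; have := q0 i; move: (q i 0%R) => c.
    by case: c => // c _; exact: (esym (natz c)).
  rewrite rowKd row_row_mx row0 row1 -delta_mx_rshift /=.
  suff -> : mv_sign (tnth del i) (tnth (map_tuple f z) i) = xi (rshift 1 i) by exact: rep_delta.
  by rewrite /xi -[rshift 1 _]/(unsplit (inr _)) unsplitK.
have [r [hr sr]] := int_sol_of_sol 1 hxi hW sz.
pose i0 := lshift m (0%R : 'I_1).
have b0 : box 1 (delta_mx 0 i0 : 'rV[int]_(1 + m))%R.
  by move=> j; rewrite mxE; case: (_ && _).
have r0 : (0 < r i0 0)%R.
  rewrite ltNge; apply/negP => h; apply: g0.
  have -> : f g = xi i0 by rewrite /xi /i0 -[lshift m _]/(unsplit (inl _)) unsplitK.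
  apply: (rep_zero hxi (rep_delta hC hxi i0)); apply/(hr _ (boxN b0)).
  by rewrite ptNl pt_delta oppr_ge0.
exists (r i0 0%R), (W *m r)%R; split=> //.
rewrite -{1}[r]vsubmxK /W mul_block_col col_mxKu mul0mx addr0.
by rewrite [usubmx r]mx11_scalar mul_mx_scalar mxE.
Qed.

End Model.

Lemma common_denominator (I : finType) (f : I -> rat) :
  exists2 d : int, (0 < d)%R & exists z : I -> int, forall i, (d%:~R * f i = (z i)%:~R)%R.
Proof.
suff [d d0 h] : exists2 d : int, (0 < d)%R &
    forall i, i \in enum I -> exists z : int, (d%:~R * f i = z%:~R)%R.
  have {}h i : exists z : int, (d%:~R * f i = z%:~R)%R by apply: h; rewrite mem_enum.
  by have [z hz] := choice h; exists d => //; exists z.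
elim: (enum I) => [|i s [d d0 h]]; first by exists 1%R.
exists (denq (f i) * d)%R; first by rewrite mulr_gt0 ?denq_gt0.
move=> j; rewrite inE => /predU1P[->|/h [z zE]].
  exists (d * numq (f i))%R.
  by rewrite [(denq _ * d)%R]mulrC !intrM -mulrA numqE [(f i * _)%R]mulrC.
by exists (denq (f i) * z)%R; rewrite !intrM -mulrA zE.
Qed.

Lemma eq_int_sol beta (p p' : 'cV[int]_(n + m)) :
  (forall l, box (depth phi) l -> (0 <= pt l p)%R = (0 <= pt l p')%R) ->
  int_sol beta p -> int_sol beta p'.
Proof.
move=> e [tp p0]; split=> [|i]; first exact: eq_test tp.
rewrite -pt_delta -e ?pt_delta // => j; rewrite mxE; by case: (_ && _).
Qed.

(* Moving a solution along a vector of the z-space that is orthogonal to all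
   forms vanishing at it preserves the signs of all relevant forms. *)
Lemma int_unique_rigid beta (p : 'cV[int]_(n + m)) (u : 'cV[int]_m) :
  int_unique beta -> int_sol beta p ->
  (forall l, box (depth phi) l -> pt l p = 0%R -> pt l (col_mx 0 u) = 0)%R -> u = 0%R.
Proof.
move=> hu sp hl; pose w : 'cV[int]_(n + m) := col_mx 0%R u.
have [B hB] := box_mul (depth phi) w.
(* At the point scaled by [B.+1], every nonzero form has absolute value above [B], so adding [w]
   cannot change its sign. *)
pose T : int := B.+1%:Z.
have sT : int_sol beta (T *: p)%R by apply/int_solZ.
have sTw : int_sol beta (T *: p + w)%R.
  apply: eq_int_sol sT => l bl; rewrite ptDr !ptZr.
  have [e|ne] := eqVneq (pt l p) 0%R; first by rewrite hl // e mulr0 addr0.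
  have := hB l bl 0%R; rewrite -/(pt l w); move: ne; rewrite /T.
  move: (pt l p) (pt l w) => a b a0 hb.
  have [a1|a1] : (1 <= a)%R \/ (a <= -1)%R by lia.
    have h : (B.+1%:Z <= B.+1%:Z * a)%R by rewrite ler_peMr.
    by apply/idP/idP; lia.
  have h : (B.+1%:Z <= B.+1%:Z * - a)%R by rewrite ler_peMr //; lia.
  by rewrite mulrN in h; apply/idP/idP; lia.
have := hu _ _ sT sTw.
have -> : usubmx (T *: p + w)%R = usubmx (T *: p)%R.
  by apply/colP => i; rewrite !mxE; case: split_ordP => j // /eqP; rewrite ?eq_lrshift // mxE addr0.
move=> /(_ erefl) /eqP; rewrite eq_sym -subr_eq0 addrAC subrr add0r => /eqP w0.
by apply/colP => i; have /colP /(_ (rshift n i)) := w0; rewrite col_mxEd !mxE.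
Qed.

End IntegralSolutions.

(** * Piecewise linearity of the solution *)

Section PiecewiseLinear.
Import Order.TTheory GRing.Theory Num.Theory.
Variable phi : efd.
Local Notation n := (efd_n phi).
Local Notation m := (efd_m phi).
Local Notation var := ('I_n + 'I_m)%type.
Variable beta : var -> bool.
Hypotheses (hu : int_unique beta) (he : int_exists beta).

(* A solution is determined by the set of forms that vanish at it. *)
Lemma int_sol_linear : exists (T : finType) (d : T -> int) (L : T -> 'M[int]_(m, n)),
  (forall t, 0 < d t)%R /\ forall q : 'cV[int]_n, (forall i, 0 <= q i 0)%R ->
  exists t, int_sol beta (col_mx (d t)%:M (L t) *m q)%R.
Proof.
have [s hs] := box_enum (n + m) (depth phi).
pose T := {ffun 'I_(size s) -> bool}.
pose A (t : T) : 'M[rat]_(size s, m) :=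
  (\matrix_(i, j) if t i then (rsubmx (nth 0 s i) 0 j)%:~R else 0)%R.
pose B (t : T) : 'M[rat]_(size s, n) :=
  (\matrix_(i, j) if t i then (lsubmx (nth 0 s i) 0 j)%:~R else 0)%R.
(* If exactly the forms in [t] vanish at (x, z), then A z + B x = 0. When A has rank m, the
   pseudoinverse is a left inverse and z = L0 x; for other patterns [L0] is a default. *)
pose L0 t : 'M[rat]_(m, n) := (- (pinvmx (A t) *m B t))%R.
have /choice [d /choice [L hL]] (t : T) : exists d : int, exists L : 'M[int]_(m, n),
    (0 < d)%R /\ (map_mx intr L = d%:~R *: L0 t)%R.
  have [d d0 [z zE]] := common_denominator (fun ij : 'I_m * 'I_n => L0 t ij.1 ij.2).
  exists d, (\matrix_(i, j) z (i, j))%R; split=> //.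
  by apply/matrixP => i j; rewrite !mxE -zE !mxE.
exists T, d, L; split=> [t|q q0]; first by case: (hL t).
have [c [p [c0 sp pq]]] := he q0.
pose t : T := [ffun i : 'I_(size s) => pt (nth 0%R s i) p == 0%R].
exists t; have [d0 LE] := hL t.
pose Q N (u : 'cV[int]_N) : 'cV[rat]_N := map_mx intr u.
have act (l : 'rV[int]_(n + m)) (u : 'cV[int]_n) (w : 'cV[int]_m) :
    pt l (col_mx u w) = ((lsubmx l *m u) 0 0 + (rsubmx l *m w) 0 0)%R.
  by rewrite /pt -{1}[l]hsubmxK mul_row_col mxE.
have rowA (w : 'cV[int]_m) i : (A t *m Q _ w)%R i 0%R =
    (if t i then ((rsubmx (nth 0 s i) *m w) 0 0)%:~R else 0)%R.
  rewrite mxE; case e: (t i); last by rewrite big1 // => j _; rewrite !mxE e mul0r.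
  by rewrite mxE rmorph_sum; apply: eq_bigr => j _; rewrite !mxE e -intrM.
have rowB (u : 'cV[int]_n) i : (B t *m Q _ u)%R i 0%R =
    (if t i then ((lsubmx (nth 0 s i) *m u) 0 0)%:~R else 0)%R.
  rewrite mxE; case e: (t i); last by rewrite big1 // => j _; rewrite !mxE e mul0r.
  by rewrite mxE rmorph_sum; apply: eq_bigr => j _; rewrite !mxE e -intrM.
(* A nonzero kernel vector, scaled to integers, is a direction excluded by rigidity. *)
have full : row_full (A t).
  apply: contraT => nfull.
  have [w w0 Aw] : exists2 w : 'cV[rat]_m, w != 0%R & (A t *m w = 0)%R.
    have : cokermx (A t) != 0%R.
      by rewrite -mxrank_eq0 mxrank_coker subn_eq0 -ltnNge ltn_neqAle rank_leq_col andbT.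
    case: (pselect (exists j, col j (cokermx (A t)) != 0%R)) => [[j j0] _|no].
      by exists (col j (cokermx (A t))) => //; rewrite colE mulmxA mulmx_coker mul0mx.
    move=> /eqP []; apply/matrixP => i j; rewrite [RHS]mxE.
    have /negP := fun h => no (ex_intro _ j h).
    by rewrite negbK => /eqP /colP /(_ i); rewrite !mxE.
  have [e e0 [z zE]] := common_denominator (fun i => w i 0%R).
  pose u : 'cV[int]_m := (\col_i z i)%R.
  have uE : Q _ u = (e%:~R *: w)%R by apply/colP => i; rewrite !mxE -zE.
  suff u0 : u = 0%R.
    move: uE; rewrite u0 /Q map_mx0 => /esym /eqP.
    by rewrite scaler_eq0 (negbTE w0) orbF intr_eq0 gt_eqF.
  apply: (int_unique_rigid hu sp) => l /hs ls lp.
  rewrite act mulmx0 mxE add0r.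
  have li : (index l s < size s)%N by rewrite index_mem.
  have := rowA u (Ordinal li); rewrite uE -scalemxAr Aw scaler0 mxE ffunE /= nth_index // lp eqxx.
  by move=> /esym /eqP; rewrite intr_eq0 => /eqP.
have eqp : (A t *m Q _ (dsubmx p) + B t *m Q _ (usubmx p) = 0)%R.
  apply/colP => i; rewrite mxE rowA rowB [RHS]mxE; case e: (t i); last by rewrite addr0.
  move: e; rewrite ffunE -{1}[p]vsubmxK act => /eqP e.
  by rewrite addrC -intrD e.
have dE : (Q _ (dsubmx p) = L0 t *m Q _ (usubmx p))%R.
  rewrite /L0 mulNmx -mulmxA -[LHS]mul1mx -(mulVpmx full) -mulmxA.
  by rewrite -mulmxN; congr (_ *m _)%R; apply/eqP; rewrite -addr_eq0 eqp.
suff e : (c *: (col_mx (d t)%:M (L t) *m q) = d t *: p)%R.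
  by apply/(int_solZ _ _ c0); rewrite e; apply/int_solZ.
rewrite mul_col_mx scale_col_mx -[p]vsubmxK scale_col_mx pq.
congr col_mx; first by rewrite mul_scalar_mx !scalerA mulrC.
suff : Q _ (c *: (L t *m q))%R = Q _ (d t *: dsubmx p)%R.
  by move=> /colP h; apply/colP => i; apply/eqP; have /eqP := h i; rewrite !mxE eqr_int.
rewrite /Q map_mxZ map_mxM [in RHS]map_mxZ LE -/(Q _ (dsubmx p)) dE pq /Q map_mxZ.
by rewrite -scalemxAl -scalemxAr !scalerA mulrC.
Qed.

(* The solution at [q] is the rational vector [p / d], up to its first [n] entries. *)
Definition clears (k : nat) : Prop :=
  forall (q : 'cV[int]_n) (d : int) (p : 'cV[int]_(n + m)) (j : 'I_m),
  (forall i, 0 <= q i 0)%R -> (0 < d)%R -> int_sol beta p -> usubmx p = (d *: q)%R ->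
  (d %| (k%:Z * p (rshift n j) 0)%R)%Z.

(** The formula for [b] is the reduced denominator of the quotient of the j-th z-entry of [p] by
    [d]. *)
Definition denominator (b : nat) : Prop :=
  exists (q : 'cV[int]_n) (d : int) (p : 'cV[int]_(n + m)) (j : 'I_m),
  [/\ (forall i, 0 <= q i 0)%R, (0 < d)%R, int_sol beta p, usubmx p = (d *: q)%R &
    b = (`|d| %/ gcdn `|d| `|p (rshift n j) 0%R|)%N].

(** Denominators divide some [d t], so finitely many occur and their product works. The [d t]
    themselves would not do: [D] stands for divisibility in models, known only for denominators that
    occur. *)
Lemma clears_exists (D : nat -> Prop) :
  D 1%N -> (forall a b, D a -> D b -> D (a * b)%N) -> (forall b, denominator b -> D b) ->
  exists k, [/\ (0 < k)%N, D k & clears k].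
Proof.
move=> D1 DM Dden; have [T [d [L [d0 hL]]]] := int_sol_linear.
have den0 b : denominator b -> (0 < b)%N.
  move=> [q [e [p [j [_ e0 _ _ ->]]]]]; rewrite divn_gt0 ?gcdn_gt0; last by lia.
  by apply: dvdn_leq; [lia|exact: dvdn_gcdl].
have [k [k0 Dk hk]] : exists k, [/\ (0 < k)%N, D k &
    forall b, (b <= \sum_t `|d t|)%N -> denominator b -> (b %| k)%N].
  elim: (\sum_t _)%N => [|N [k [k0 Dk hk]]].
    by exists 1%N; split=> // b; rewrite leqn0 => /eqP -> /den0.
  have [hd|nd] := pselect (denominator N.+1).
    exists (N.+1 * k)%N; split=> [||b]; [by rewrite muln_gt0|by apply: DM => //; exact: Dden|].
    rewrite leq_eqVlt => /predU1P[-> _|bN hb]; first exact: dvdn_mulr.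
    by apply: dvdn_mull; exact: hk.
  exists k; split=> // b; rewrite leq_eqVlt => /predU1P[-> //|]; exact: hk.
exists k; split=> // q e p j q0 e0 sp pq.
have [t st] := hL q q0; set p1 := (_ *m q)%R in st.
have p1q : usubmx p1 = (d t *: q)%R by rewrite /p1 mul_col_mx col_mxKu mul_scalar_mx.
clearbody p1.
(* Both sides are integer solutions over the same multiple of [q]. *)
have pp1 : (d t *: p = e *: p1)%R.
  apply: hu; try by apply/int_solZ.
  by rewrite !linearZ /= pq p1q !scalerA mulrC.
have dvd1 : (`|d t| %| k * `|p1 (rshift n j) 0%R|)%N.
  pose g := gcdn `|d t| `|p1 (rshift n j) 0%R|.
  have hb : denominator (`|d t| %/ g)%N by exists q, (d t), p1, j.
  have gl : (g %| `|d t|)%N := dvdn_gcdl _ _.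
  have gr : (g %| `|p1 (rshift n j) 0%R|)%N := dvdn_gcdr _ _.
  have gk : (`|d t| %/ g %| k)%N.
    apply: hk hb; apply: leq_trans (leq_div _ _) _.
    by rewrite (bigD1 t) //= leq_addr.
  clearbody g; have [c ->] := dvdnP gr; rewrite mulnA mulnAC.
  by rewrite -{1}(divnK gl) dvdn_mulr // dvdn_mul.
have /colP /(_ (rshift n j)) := pp1; rewrite !mxE => eP.
have /dvdzP [c cE] : (d t %| (k%:Z * p1 (rshift n j) 0)%R)%Z.
  by rewrite dvdzE abszM absz_nat.
apply/dvdzP; exists c; apply: (mulfI (x := d t)); first by rewrite gt_eqF.
by rewrite mulrCA eP [LHS]mulrCA cE mulrCA [RHS]mulrCA [(e * _)%R]mulrC.
Qed.

End PiecewiseLinear.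

(** * Divisible chains *)

Section ChainSolutions.
Import Order.TTheory GRing.Theory Num.Theory.
Variable phi : efd.
Local Notation n := (efd_n phi).
Local Notation m := (efd_m phi).
Local Notation var := ('I_n + 'I_m)%type.
Variables (C : mvstruct) (hC : pchain C).
Let mvC := pchain_mv hC.
Variable beta : var -> bool.

Definition inf_divisible (k : nat) : Prop :=
  forall g : C, inf g -> exists2 y : C, inf y & y *+ k = g.

(** Homogeneity inside a chain: forms keep their signs at the D-th multiples. It brings a solution
    over [q] to the same x-part as an integer solution over [d *: q]. *)
Lemma sol_scale (v : var -> C) D : (0 < D)%N ->
  (forall i, inf (mv_sign (beta i) (v i))) -> sol v ->
  sol (fun i => mv_sign (beta i) (mv_sign (beta i) (v i) *+ D)).
Proof.
move=> D0 iv sv.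
pose xi (i : 'I_(n + m)) := mv_sign (beta (split i)) (v (split i)).
have hxi i : inf (xi i) by rewrite /xi.
have xiE i : xi (idx i) = mv_sign (beta i) (v i) by rewrite /xi /idx unsplitK.
have hv i : srep hC xi (v i) (beta i) (row (idx i) 1%:M%R).
  by rewrite row1 /srep -/(mv_sign _ _) -xiE; exact: rep_delta.
pose O l := `[< nneg hC xi l >].
have tO : test O beta.
  apply: (test_of_sol hxi hv) => // l _; rewrite mulmx1.
  by split=> /asboolP.
have hw i : srep hC xi (mv_sign (beta i) (mv_sign (beta i) (v i) *+ D)) (beta i)
    (row (idx i) (D%:R%:M)%R).
  rewrite /srep -/(mv_sign _ _) mv_signK // -xiE.
  have -> : (row (idx i) (D%:R%:M) = delta_mx 0 (idx i) *+ D :> 'rV[int]_(n + m))%R.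
    by rewrite -scalemx1 linearZ /= row1 scaler_nat.
  by apply: rep_nat => //; exact: rep_delta.
apply: (sol_of_test hxi hw _ tO) => l _; rewrite mul_mx_scalar scaler_nat.
have cn := nneg_cone hC hxi.
apply: (coneMn cn); rewrite /O; case: asboolP => // h.
by case: (nneg_total hC hxi l).
Qed.

(* If [b] is the reduced denominator of the [j]-th coordinate of the solution at
   [q], then solving at the multiples [q g] produces [(a / b) g] with [a] prime
   to [b], and Bezout gives [g / b]. *)
Lemma inf_divisible_denominator b :
  int_unique beta -> denominator beta b ->
  (forall x : 'I_n -> C, (forall i, inf (mv_sign (beta (inl i)) (x i))) ->
     exists v : var -> C, [/\ forall i, v (inl i) = x i,
       forall i, inf (mv_sign (beta i) (v i)) & sol v]) ->
  inf_divisible b.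
Proof.
move=> hu [q [d [p [j [q0 d0 sp pq bE]]]]] hex g ig.
have [|v [vx iv sv]] := hex (fun i => mv_sign (beta (inl i)) (g *+ `|q i 0%R|%N)).
  by move=> i; rewrite mv_signK //; exact: inf_nat.
pose D := `|d|%N; have D0 : (0 < D)%N by rewrite /D; lia.
have p0 i : (0 <= p i 0)%R by case: sp.
have im i : inf (mv_sign (beta i) (multiples g beta p i)).
  by rewrite /multiples mv_signK //; exact: inf_nat.
have iD i : inf (mv_sign (beta i) (mv_sign (beta i) (mv_sign (beta i) (v i) *+ D))).
  by rewrite mv_signK //; exact: inf_nat.
have eq_in i : mv_sign (beta (inl i)) (mv_sign (beta (inl i)) (v (inl i)) *+ D) =
    multiples g beta p (inl i).
  rewrite vx mv_signK // /multiples -mv_natM //; congr (mv_sign _ (_ *+ _)).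
  by have /colP /(_ i) := pq; rewrite !mxE -/(idx (inl i)) => ->; rewrite abszM.
have := chain_unique hC hu iD im (sol_scale D0 iv sv) (sol_multiples_chain hC ig sp) eq_in.
move=> /(_ (inr j)) /(congr1 (mv_sign (beta (inr j)))); rewrite /multiples !mv_signK //.
rewrite -[idx (inr j)]/(rshift n j).
set z := mv_sign _ _; set P := `|p _ _|%N => zE.
have iz : inf z by exact: iv.
have g0 : (0 < gcdn D P)%N by rewrite gcdn_gt0 D0.
have DE : (D = gcdn D P * b)%N by rewrite bE mulnC divnK // dvdn_gcdl.
have PE : (P = gcdn D P * (P %/ gcdn D P))%N by rewrite mulnC divnK // dvdn_gcdr.
have cop : coprime (P %/ gcdn D P) b.
  rewrite coprime_sym bE /coprime -(eqn_pmul2r g0) muln_gcdl.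
  by rewrite !divnK ?dvdn_gcdl ?dvdn_gcdr // mul1n.
set a := (P %/ gcdn D P)%N in PE cop.
have zab : z *+ b = g *+ a.
  apply: (inf_natI hC g0); try exact: inf_nat.
  by rewrite -!mv_natM // -DE -PE.
(* Coprimality to 0 leaves only b = 1. *)
have [a0|a0] := posnP a.
  exists g => //; move: cop; rewrite a0 /coprime gcd0n => /eqP -> //.
case: (egcdnP b a0) => u w uw _; rewrite (eqP cop) in uw.
have e : (z *+ u) *+ b = (g *+ w) *+ b + g.
  rewrite -!mv_natM // mulnC mv_natM // zab -mv_natM // mulnC [(a * u)%N]mulnC uw.
  by rewrite mv_natD // mulnC.
have b0 : (0 < b)%N by move: D0; rewrite DE muln_gt0 => /andP[].
case: (pchain_total hC (g *+ w) (z *+ u)) => h.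
  have iy : inf (mv_sub (z *+ u) (g *+ w)).
    by apply: inf_le (inf_nat hC u iz) => //; exact: mv_sub_le.
  exists (mv_sub (z *+ u) (g *+ w)) => //.
  rewrite -{1}(mv_subK mvC h) mv_natDl // [RHS](mv_addC mvC) in e.
  exact: inf_addIr (inf_nat hC _ (inf_nat hC _ ig)) (inf_nat hC _ iy) ig e.
(* If uz lies below wg, the Bezout equation forces g = 0. *)
exists 0; [exact: inf0|rewrite mv_nat0x //].
rewrite -(mv_subK mvC h) mv_natDl // in e.
set y := mv_sub _ _ in e.
have iy : inf y by apply: inf_le (inf_nat hC w ig) => //; exact: mv_sub_le.
have izb : inf ((z *+ u) *+ b) by do 2!apply: inf_nat => //.
have iyg : inf (y *+ b + g) by apply: infD => //; exact: inf_nat.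
have := inf_addIr hC izb (inf0 hC) iyg.
rewrite mv_add0x // -mv_addA // [g + _]mv_addC // mv_addA // -e => /(_ erefl) h1.
apply: esym; apply: (inf_add_eq0 hC (y := y *+ b)).
by rewrite mv_addC.
Qed.

(** With x = ky, the linear piece at a generic integer point imitating y gives z = (L / d) ky,
    provided that kL / d is an integer matrix. Genericity makes the piece valid at y too: a relevant
    form nonzero on the piece has its sign at y decided by the point. *)
Lemma chain_solution k : int_unique beta -> int_exists beta -> (0 < k)%N ->
  clears beta k -> inf_divisible k ->
  forall x : 'I_n -> C, (forall i, inf (mv_sign (beta (inl i)) (x i))) ->
  exists v : var -> C, (forall i, v (inl i) = x i) /\ sol v.
Proof.
move=> hu he k0 hk hdiv x ix.
have [T [d [L [d0 hL]]]] := int_sol_linear hu he.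
have /choice [y hy] (i : 'I_n) : exists y : C, inf y /\ y *+ k = mv_sign (beta (inl i)) (x i).
  by have [y iy yE] := hdiv _ (ix i); exists y.
have iy i : inf (y i) by case: (hy i).
have cn := nneg_cone hC iy.
pose W t : 'M[int]_(n + m, n) := col_mx (d t)%:M (L t).
have [K2 hK2] : exists K2, forall t l, box (depth phi) l -> box K2 (l *m W t)%R.
  have /choice [f hf] := fun t => box_mul (depth phi) (W t).
  exists (\sum_t f t)%N => t l bl; apply: box_le (hf t l bl).
  by rewrite (bigD1 t) //= leq_addr.
have [q [qgen qpos]] := cone_generic K2 cn.
have q0 i : (0 <= q i 0)%R.
  by apply: qpos; exists (y i); exact: rep_delta.
have [t st] := hL q q0.
have top (r : 'cV[int]_n) : usubmx (W t *m r)%R = (d t *: r)%R.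
  by rewrite mul_col_mx col_mxKu mul_scalar_mx.
have bot (r : 'cV[int]_n) j : (W t *m r)%R (rshift n j) 0%R = (L t *m r)%R j 0%R.
  by rewrite mul_col_mx col_mxEd.
have dvdL j i : (d t %| (k%:Z * L t j i)%R)%Z.
  (* Adding a basis vector to a large multiple of [q] keeps the signs of the relevant forms, which
     are nonzero at [q] unless they vanish identically. So [q'] lies on the same piece, and the two
     divisibilities differ by the entry (j, i). *)
  pose S : int := K2.+1%:Z%R; pose q' : 'cV[int]_n := (S *: q + delta_mx i 0)%R.
  have q'0 i' : (0 <= q' i' 0)%R.
    by rewrite !mxE addr_ge0 // ?mulr_ge0 //; case: (_ && _).
  have st' : int_sol beta (W t *m q')%R.
    apply: eq_int_sol st => l bl; rewrite -!pt_mul.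
    have bu := hK2 t l bl; set u := (l *m W t)%R in bu *.
    have [->|u0] := eqVneq u 0%R; first by rewrite !pt0l.
    have [a0 _] := qgen u bu u0.
    have ui : pt u (delta_mx i 0)%R = u 0%R i by rewrite /pt -colE mxE.
    rewrite /q' ptDr ptZr ui /S; have := bu i.
    move: (pt u q) a0 (u 0%R i) => a a0 c hc.
    have [a1|a1] : (1 <= a)%R \/ (a <= -1)%R by lia.
      have h : (K2.+1%:Z <= K2.+1%:Z * a)%R by rewrite ler_peMr.
      by apply/idP/idP; lia.
    have h : (K2.+1%:Z <= K2.+1%:Z * - a)%R by rewrite ler_peMr //; lia.
    by rewrite mulrN in h; apply/idP/idP; lia.
  have h1 := hk q (d t) _ j q0 (d0 t) st (top q).
  have h2 := hk q' (d t) _ j q'0 (d0 t) st' (top q').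
  rewrite !bot in h1 h2.
  have e : ((L t *m q') j 0 = S * (L t *m q) j 0 + L t j i)%R.
    by rewrite /q' mulmxDr -scalemxAr -colE !mxE.
  rewrite e mulrDr mulrCA in h2.
  by move: h2; rewrite rpredDl //; exact: dvdz_mull.
pose L' : 'M[int]_(m, n) := (\matrix_(j, i) (k%:Z * L t j i %/ d t)%Z)%R.
have L'E : (d t *: L' = k%:Z *: L t)%R.
  by apply/matrixP => j i; rewrite !mxE mulrC divzK.
pose W' : 'M[int]_(n + m, n) := (col_mx k%:Z%:M L')%R.
have W'E : (d t *: W' = k%:Z *: W t)%R.
  rewrite /W' /W !scale_col_mx L'E; congr col_mx.
  by rewrite !scale_scalar_mx mulrC.
have comp : compat hC y (fun l => 0 <= pt l (W t *m q))%R W' (depth phi).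
  move=> l bl; set l1 := (if _ then _ else _).
  have bl1 : box (depth phi) l1 by rewrite /l1; case: ifP => // _; exact: boxN.
  have l10 : (0 <= pt l1 (W t *m q))%R.
    by rewrite /l1; case: ifP => // /negbT; rewrite -ltNge ptNl oppr_ge0 => /ltW.
  have bu := hK2 t l1 bl1.
  have uE : (d t *: (l1 *m W') = k%:Z *: (l1 *m W t))%R by rewrite !scalemxAr W'E.
  have [u0|u0] := eqVneq (l1 *m W t)%R 0%R.
    move: uE; rewrite u0 scaler0 => /eqP; rewrite scalemx_eq0 gt_eqF //= => /eqP ->.
    exact: (cone0 cn).
  have [a0 a1] := qgen _ bu u0.
  have Pu : nneg hC y (l1 *m W t)%R by apply: a1; rewrite lt_def a0 pt_mul.
  apply: (coneMn_inv cn (k := `|d t|%N)); first by have := d0 t; lia.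
  suff -> : ((l1 *m W') *+ `|d t| = (l1 *m W t) *+ k)%R by exact: coneMn.
  by rewrite -[LHS]scaler_nat -[RHS]scaler_nat !natz gez0_abs // ltW.
have /choice [z hz] (j : 'I_m) : exists z : C, rep hC y z (row j L').
  have := comp (delta_mx 0 (rshift n j))%R; case: ifP => [_|].
    rewrite -rowE /W' rowKd; apply=> i; rewrite mxE; by case: (_ && _).
  by rewrite pt_delta; case: st => _ ->.
pose v (i : var) := match i with inl i => x i | inr j => mv_sign (beta (inr j)) (z j) end.
have hv i : srep hC y (v i) (beta i) (row (idx i) W').
  rewrite /srep -/(mv_sign _ _); case: i => i; rewrite /idx /unsplit /W' ?rowKu ?rowKd.
    have [_ /= <-] := hy i.
    have -> : (row i (k%:Z%:M) = delta_mx 0 i *+ k :> 'rV[int]_n)%R.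
      by rewrite -[RHS]scaler_nat natz -scalemx1 linearZ /= row1.
    by apply: rep_nat => //; exact: rep_delta.
  by rewrite /= mv_signK.
exists v; split=> //; apply: (sol_of_test iy hv comp).
by case: st.
Qed.

End ChainSolutions.

(** * Divisible chains and the term [mv_t] *)

Section DivisibleChains.
Variables (C : mvstruct) (hC : pchain C).
Let mvC := pchain_mv hC.

Lemma sol_bits phi (x : (efd_n phi).-tuple C) (z : (efd_m phi).-tuple C) del :
  satisfies two phi -> sol (valuation x z) ->
  sol (valuation (map_tuple (@bit C) x : (efd_n phi).-tuple two) del) ->
  forall i, inf (mv_sign (valuation (map_tuple (@bit C) x) del i) (valuation x z i)).
Proof.
move=> s2 /(sol_map (bit_hom hC)) sz sd; have <- := satisfies_unique s2 sz sd.
by case=> i /=; rewrite tnth_map; exact: inf_bit.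
Qed.

Lemma chain_satisfies phi k : satisfies two phi -> (0 < k)%N -> inf_divisible C k ->
  (forall beta, @int_unique phi beta) ->
  (forall (eps : (efd_n phi).-tuple two) del, sol (valuation eps del) ->
     int_exists (valuation eps del) /\ clears (valuation eps del) k) ->
  satisfies C phi.
Proof.
move=> s2 k0 hdiv hu hk x; set eps : (efd_n phi).-tuple two := map_tuple (@bit C) x.
have [del [sd _]] := s2 eps; have [he hcl] := hk eps del sd.
have [i|v [vx sv]] := chain_solution hC (hu _) he k0 hcl hdiv (x := tnth x).
  by rewrite /= tnth_map; exact: inf_bit.
pose z := mktuple (fun j => v (inr j)).
have vE i : v i = valuation x z i by case: i => i /=; rewrite ?tnth_mktuple.
have sz : sol (valuation x z) by move=> i; have := sv i; rewrite (funext vE).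
exists z; split=> // z' sz'; apply: eq_from_tnth => j.
have iz := sol_bits s2 sz sd; have iz' := sol_bits s2 sz' sd.
exact: (chain_unique hC (hu _) iz iz' sz sz' _ (inr j)).
Qed.

(** The term multiplies infinitesimal parts by k on both sides of the chain: 2z^2 is 0 at an
    infinitesimal and 1 at the negation of one, so it selects between kz and z^k. *)
Lemma mv_t_inf k (z : C) : (0 < k)%N -> inf z -> mv_t k z = z *+ k.
Proof.
case: k => // k _ iz; rewrite /mv_t.
have -> : z ^+ 2 = 0 by exact: iz.
rewrite mv_nat0x // mv_meet_idl //; last exact: mv_lex1.
apply: (mv_join_idl mvC); apply: (mv_le_trans mvC (y := z)).
  case: k => [|k]; first exact: mv_le_refl.
  by rewrite -[z ^+ k.+2]/(z * z ^+ k.+1) mv_mulE; exact: mv_sub_le.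
by rewrite mv_natS //; exact: mv_le_addr.
Qed.

Lemma mv_t_neg_inf k (z : C) : inf (~` z) -> mv_t k z = ~` ((~` z) *+ k).
Proof.
move=> iz; rewrite /mv_t -mv_expE //.
have -> : (z ^+ 2) *+ 2 = ~` 0.
  have := pchain_inf hC iz; rewrite {1}/mv_mul.
  rewrite -[z ^+ 2]/(z * z) -[_ *+ 2]/(z * z + z * z) /mv_mul => e.
  by rewrite -[LHS]mv_negK // e.
rewrite mv_negK // mv_meet_idr //; last exact: mv_le0x.
by apply: mv_le0x.
Qed.

Lemma mv_tI k (z z' : C) : (0 < k)%N -> mv_t k z = mv_t k z' -> z = z'.
Proof.
move=> k0; case: (inf_or hC z) => iz; case: (inf_or hC z') => iz';
  rewrite ?(mv_t_inf k0 iz) ?(mv_t_inf k0 iz') ?(mv_t_neg_inf k iz) ?(mv_t_neg_inf k iz').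
- exact: inf_natI.
- move=> e; case: (inf_neg hC (inf_nat hC k iz')); rewrite -e; exact: inf_nat.
- move=> e; case: (inf_neg hC (inf_nat hC k iz)); rewrite e; exact: inf_nat.
- move=> /(congr1 (@mv_neg C)); rewrite !mv_negK // => /(inf_natI hC k0 iz iz').
  by move=> /(congr1 (@mv_neg C)); rewrite !mv_negK.
Qed.

Lemma mv_t_surj_divisible k : (0 < k)%N ->
  (forall x : C, exists z, mv_t k z = x) -> inf_divisible C k.
Proof.
move=> k0 h g ig; have [z zE] := h g; case: (inf_or hC z) => iz.
  by exists z => //; rewrite -mv_t_inf.
by case: (inf_neg hC (inf_nat hC k iz)); rewrite -mv_t_neg_inf // zE.
Qed.

Lemma mv_t_surj_of_divisible k : (0 < k)%N ->
  inf_divisible C k -> forall x : C, exists z, mv_t k z = x.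
Proof.
move=> k0 h x; case: (inf_or hC x) => ix.
  by have [y iy yE] := h x ix; exists y; rewrite mv_t_inf.
have [y iy yE] := h _ ix; exists (~` y).
by rewrite mv_t_neg_inf mv_negK // yE mv_negK.
Qed.

End DivisibleChains.

Lemma hom_exp (A B : mvstruct) (f : A -> B) (x : A) k :
  mv_hom f -> f (x ^+ k) = f x ^+ k.
Proof.
move=> hf; case: k => [|k]; first by rewrite /mv_exp /= (mv_homN hf) (mv_hom0 hf).
elim: k => [|k IH] //; rewrite -[x ^+ k.+2]/(x * x ^+ k.+1) (hom_mul hf) IH.
by [].
Qed.

Lemma hom_t (A B : mvstruct) (f : A -> B) (x : A) k :
  mv_hom f -> f (mv_t k x) = mv_t k (f x).
Proof.
move=> hf; rewrite /mv_t (hom_join hf) (hom_meet hf) (mv_homN hf) !(hom_nat hf).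
by rewrite !(hom_exp _ _ hf).
Qed.

Lemma epsilonP k (A : mvstruct) :
  satisfies A (epsilon k) <-> forall x : A, exists! z, mv_t k z = x.
Proof.
(* Terms form a structure and evaluation is a homomorphism from it, so [hom_t] computes the formal
   term in [epsilon]. *)
have eval_hom (V : Type) (v : V -> A) : mv_hom (eval v : term_mvstruct V -> A) by [].
have evalE (x z : 1.-tuple A) (i : 'I_1) :
    eval (valuation x z) (efd_lhs (e := epsilon k) i) = mv_t k (thead z).
  exact: (hom_t _ k (eval_hom _ (valuation x z))).
split=> [h x|h x].
  have [z [sz uz]] := h [tuple x]; exists (thead z); split.
    by have := sz ord0; rewrite evalE.
  move=> z' z'E; suff -> : z = [tuple z'] by [].
  by apply: uz => i; rewrite evalE.
have [z [zE uz]] := h (thead x); exists [tuple z]; split=> [i|z' sz'].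
  by rewrite evalE theadE zE.
have -> : z' = [tuple thead z'] by apply: eq_from_tnth => i; rewrite ord1.
rewrite -(uz (thead z')) //.
by have := sz' ord0; rewrite evalE.
Qed.

(** * The choice of k *)

Section FromModel.
Variables (phi : efd) (A : mvstruct) (x0 : A).
Hypotheses (VA : generated_variety perfect A) (sA : satisfies A phi).
Hypotheses (xx : x0 + x0 <> x0) (s2 : satisfies two phi).

Lemma epsilon_exists : exists2 k : nat, (0 < k)%N &
  equivalent_in (generated_variety perfect)
    (fun B => satisfies B phi) (fun B => satisfies B (epsilon k)).
Proof.
have hu := int_unique_of_model VA sA xx.
have he eps del := int_exists_of_model VA sA xx (eps := eps) (del := del) s2.
have /choice [del hdel] := s2.
(* All models enter, since k may depend on the sentence only. Chain quotients inherit existence from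
   the model and get uniqueness from [hu]. *)
pose D b := forall (B C : mvstruct) (p : B -> C), generated_variety perfect B ->
  satisfies B phi -> mv_chain C -> mv_hom p -> onto p -> inf_divisible C b.
have D1 : D 1%N by move=> B C p _ _ _ _ _ g ig; exists g.
have DM a b : D a -> D b -> D (a * b)%N.
  move=> Da Db B C p VB sB cC hp sp g ig; have hC := pchain_quotient VB cC hp sp.
  have [y iy <-] := Da B C p VB sB cC hp sp g ig.
  have [w iw <-] := Db B C p VB sB cC hp sp y iy.
  by exists w => //; rewrite mv_natM //; exact: pchain_mv.
have Dden eps b : denominator (valuation eps (del eps)) b -> D b.
  move=> hb B C p VB sB cC hp sp; have hC := pchain_quotient VB cC hp sp.
  apply: (inf_divisible_denominator hC (hu _) hb) => x ix.
  have [X XE] := onto_tuple (mktuple x) sp; have [z [sz _]] := sB X.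
  have := sol_map hp sz; rewrite XE => {}sz.
  have bE : map_tuple (@bit C) (mktuple x) = eps.
    by apply: eq_from_tnth => i; rewrite tnth_map tnth_mktuple; exact: bitE (ix i).
  exists (valuation (mktuple x) (map_tuple p z)); split=> // [i|i].
    exact: tnth_mktuple.
  by rewrite -{1}bE; apply: sol_bits => //; rewrite bE; case: (hdel eps).
have /choice [k hk] (eps : (efd_n phi).-tuple bool) : exists k, [/\ (0 < k)%N, D k &
    clears (valuation eps (del eps)) k].
  have [sd _] := hdel eps.
  exact: (clears_exists (hu _) (he _ _ sd) D1 DM (Dden eps)).
(* One factor for each sign pattern of the x-variables; multiples of a clearing number still
   clear. *)
pose K := (\prod_eps k eps)%N.
have K0 : (0 < K)%N by apply: prodn_gt0 => eps; case: (hk eps).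
have DK : D K by rewrite /K; elim/big_ind: _ => // eps _; case: (hk eps).
have cK (eps : (efd_n phi).-tuple two) d : sol (valuation eps d) ->
    int_exists (valuation eps d) /\ clears (valuation eps d) K.
  move=> sd; have de : del eps = d by case: (hdel eps) => _; exact.
  split; first exact: he.
  move=> q e p j q0 e0 sp pq; rewrite -de in sp; have [_ _ ck] := hk eps.
  have := ck q e p j q0 e0 sp pq; rewrite !intdiv.dvdzE !abszM !absz_nat => h.
  by rewrite /K (bigD1 eps) //= mulnAC dvdn_mulr.
exists K => // B VB; have mvB := generated_variety_mv VB; split=> sB.
  apply: (satisfies_of_chains mvB) => C p cC hp sp.
  have hC := pchain_quotient VB cC hp sp.
  apply/epsilonP => x.
  have [z zE] := mv_t_surj_of_divisible hC K0 (DK B C p VB sB cC hp sp) x.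
  by exists z; split=> // z' z'E; apply: (mv_tI hC K0); rewrite zE.
apply: (satisfies_of_chains mvB) => C p cC hp sp.
have hC := pchain_quotient VB cC hp sp.
apply: (chain_satisfies hC s2 K0) => //.
apply: (mv_t_surj_divisible hC K0) => x; have [y <-] := sp x.
have [z [zE _]] := (epsilonP K B).1 sB y; exists (p z).
by rewrite -hom_t // zE.
Qed.

End FromModel.

(** Idempotence leaves 0 as the only infinitesimal of a chain quotient, so [bit] and [of_two]
    identify that quotient with the two-element algebra. *)
Lemma boolean_satisfies (phi : efd) (A : mvstruct) :
  generated_variety perfect A -> satisfies two phi ->
  (forall x : A, x + x = x) -> satisfies A phi.
Proof.
move=> VA s2 idem; have mvA := generated_variety_mv VA.
apply: (satisfies_of_chains mvA) => C p cC hp sp.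
have hC := pchain_quotient VA cC hp sp; have mvC := pchain_mv hC.
have bK (c : C) : of_two C (bit c) = c.
  have inf_eq0 (w : C) : inf w -> w = 0.
    move=> iw; have [a aE] := sp w.
    have ww : w + w = 0 + w by rewrite mv_add0x // -aE -(mv_homD hp) idem.
    exact: (inf_addIr hC iw iw (inf0 hC) ww).
  have := inf_bit hC c; rewrite /of_two; case: (bit c) => /= /inf_eq0 <- //.
  by rewrite mv_negK.
have {}bK l (t : l.-tuple C) : map_tuple (of_two C) (map_tuple (@bit C) t) = t.
  by apply: eq_from_tnth => i; rewrite !tnth_map bK.
move=> x; have [d [sd ud]] := s2 (map_tuple (@bit C) x).
exists (map_tuple (of_two C) d); split=> [|z sz].
  by have := sol_map (of_two_hom mvC) sd; rewrite bK.
rewrite -[RHS]bK; congr (map_tuple _ _); apply: ud.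
exact: sol_map (bit_hom hC) sz.
Qed.

Theorem theorem5p14 (phi : efd)
    (hphi : exists2 A : mvstruct, perfect A & satisfies A phi) :
  equivalent_in (generated_variety perfect)
    (fun A => satisfies A phi) (fun A => forall x : A, (x *+ 2)%mv = x)
  \/ exists2 k : nat, 0 < k &
       equivalent_in (generated_variety perfect)
         (fun A => satisfies A phi) (fun A => satisfies A (epsilon k)).
Proof.
have s2 : satisfies two phi.
  have [A pA sA] := hphi; have [mvA [x [y xy]] _] := pA.
  apply: (two_satisfies _ _ sA); first by move=> W _; apply.
  move=> e; apply: xy; rewrite -[x](mv_addx0 mvA) -[y](mv_addx0 mvA) e.
  by rewrite !mv_addx1.
have [[A [x [VA sA xx]]]|none] := pselect (exists (A : mvstruct) (x : A),
    [/\ generated_variety perfect A, satisfies A phi & x + x <> x]).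
  by right; exact: epsilon_exists VA sA xx s2.
left=> A VA; split=> [sA x|idem]; last exact: boolean_satisfies.
by apply: contrapT => xx; apply: none; exists A, x.
Qed.
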